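(* Let $X_T^{ESQ}$, $X_T^{ESP}$, $X_T^{VaR}$, $X_T^{AVaR}$ denote the optimal terminal wealths of Problems ESQ, ESP, VaR and AVaR, respectively. (i) For each given VaR constraint $\mathbb P(X_T\ge L)\ge1-\alpha$ with $L\le\widehat D_T$, there exist one ESQ constraint $\mathbb E[\xi(L-X_T)^+]\le\epsilon_{\mathbb Q}(\alpha)$ and one ESP constraint $\mathbb E[(L-X_T)^+]\le\epsilon_{\mathbb P}(\alpha)$ such that $X_T^{VaR}=X_T^{ESQ}=X_T^{ESP}$. With the same regulatory threshold $L$, the equivalent ESP constraint and the equivalent ESQ constraint are unique. (ii) For each given AVaR constraint $\frac1\alpha\int_0^\alpha VaR_{X_T}(\beta)\,d\beta\ge L^{AVaR}$ whose implicit threshold satisfies $L^{*}\le\widehat D_T$, there exist one VaR constraint $\mathbb P(X_T\ge L^{*})\ge1-\alpha(L^{*})$, one ESQ constraint $\mathbb E[\xi(L^{*}-X_T)^+]\le\epsilon_{\mathbb Q}(L^{*})$ and one ESP constraint $\mathbb E[(L^{*}-X_T)^+]\le\epsilon_{\mathbb P}(L^{*})$ such that $X_T^{AVaR}=X_T^{ESQ}=X_T^{ESP}=X_T^{VaR}$. The equivalent ESP, ESQ and VaR constraints of this form are unique.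
   Context: Market. Fix $T<\infty$ and a complete, frictionless continuous-time financial market with one risk-free asset $S_0$ and $m$ risky assets on a filtered probability space with physical measure $\mathbb P$ and unique local martingale measure $\mathbb Q$. $\mathbb E$ denotes expectation under $\mathbb P$. The state price density at time $T$ is $\xi=\frac{S_0(0)}{S_0(T)}\frac{d\mathbb Q}{d\mathbb P}$, assumed to be atomless. The initial capital is $x_0>0$, and $\mathcal X$ is the set of all $\mathcal F_T$-measurable, replicable, non-negative terminal wealths $X_T$ with $\mathbb E[\xi X_T]=x_0$. Utility and debt. $D_T>0$ is a constant (terminal debt level). $U:[0,\infty)\to\mathbb R$ is strictly increasing, strictly concave, continuously differentiable on $(0,\infty)$, bounded from below with $U(0)=0$, and satisfies $\lim_{x\to0}U'(x)=\infty$, $\lim_{x\to\infty}U'(x)=0$, $\limsup_{x\to\infty}xU'(x)/U(x)<1$. $\widehat D_T>D_T$ is the unique solution of $U(\widehat D_T-D_T)/\widehat D_T=U'(\widehat D_T-D_T)$. Problems. Each problem is $\max_{X_T\in\mathcal X}\mathbb E[U((X_T-D_T)^+)]$ subject to $\mathbb E[\xi X_T]\le x_0$ and one risk constraint: ESQ: $\mathbb E[\xi(L-X_T)^+]\le\epsilon_{\mathbb Q}$; ESP: $\mathbb E[(L-X_T)^+]\le\epsilon_{\mathbb P}$; VaR: $\mathbb P(X_T\ge L)\ge1-\alpha$; AVaR: $\frac1\alpha\int_0^\alpha VaR_{X_T}(\beta)\,d\beta\ge L^{AVaR}$, where $VaR_{X_T}(\beta)=\sup\{x\mid\mathbb P(X_T<x)\le\beta\}$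 and $0<\alpha<1$. Implicit threshold: $L^{*}>L^{AVaR}$ is a constant for which the optimal solution of Problem AVaR coincides with the optimal solution of Problem ESP with constraint $\mathbb E[(L^{*}-X_T)^+]\le\alpha(L^{*}-L^{AVaR})$. Standing assumptions: optimal solutions exist, and the given risk constraint is non-redundant, i.e. the optimal solution $X_T^B=[(U')^{-1}(\lambda_B\xi)+D_T]\mathbf 1_{\xi<\xi_B}$ of the problem without risk constraint (with $\xi_B=U'(\widehat D_T-D_T)/\lambda_B$ and $\lambda_B$ solving $\mathbb E[\xi X_T^B]=x_0$) violates it.
   Formalization: E[ξ]<∞ is assumed (otherwise no ESQ constraint with L>0 is feasible); for thresholds at or below D_T, where the ESQ optimum need not be unique, the equality with X^ESQ means that the given wealth is an optimal solution of Problem ESQ. *)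

(* Defs.v *)
From mathcomp Require Export all_boot all_order all_algebra.
From mathcomp Require Export all_classical all_reals all_analysis.

Set Implicit Arguments.
Unset Strict Implicit.
Unset Printing Implicit Defensive.

Import Order.TTheory GRing.Theory Num.Theory.
Import numFieldNormedType.Exports.

Local Open Scope classical_set_scope.
Local Open Scope ring_scope.

(** * Continuous-time processes on [[0, Tm]] *)

Definition filtration (R : realType) d (Om : measurableType d) (Tm : R)
    (F : R -> set (set Om)) : Prop :=
  [/\ forall t : R, 0 <= t <= Tm -> sigma_algebra setT (F t),
      forall s t : R, 0 <= s -> s <= t -> t <= Tm -> F s `<=` F t &
      forall A, F Tm A <-> measurable A].

Definition adapted (R : realType) d (Om : measurableType d) (Tm : R)
    (F : R -> set (set Om)) (X : R -> Om -> R) : Prop :=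
  forall t : R, 0 <= t <= Tm ->
  forall B : set R, measurable B -> F t (X t @^-1` B).

Definition stopping_time (R : realType) d (Om : measurableType d) (Tm : R)
    (F : R -> set (set Om)) (tau : Om -> R) : Prop :=
  (forall w, 0 <= tau w) /\
  forall t : R, 0 <= t <= Tm -> F t [set w | tau w <= t].

Definition martingale (R : realType) d (Om : measurableType d)
    (Q : probability Om R) (Tm : R) (F : R -> set (set Om))
    (X : R -> Om -> R) : Prop :=
  [/\ adapted Tm F X,
      forall t : R, 0 <= t <= Tm -> Q.-integrable setT (EFin \o X t) &
      forall s t : R, 0 <= s -> s <= t -> t <= Tm -> forall A, F s A ->
        (\int[Q]_(w in A) (X t w)%:E = \int[Q]_(w in A) (X s w)%:E)%E].

Definition stopped (R : realType) (Om : Type) (tau : Om -> R)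
    (X : R -> Om -> R) : R -> Om -> R :=
  fun t w => X (Num.min t (tau w)) w.

Definition local_martingale (R : realType) d (Om : measurableType d)
    (Q : probability Om R) (Tm : R) (F : R -> set (set Om))
    (X : R -> Om -> R) : Prop :=
  adapted Tm F X /\
  exists tau : nat -> Om -> R,
    [/\ forall n, stopping_time Tm F (tau n),
        forall n w, tau n w <= tau n.+1 w,
        {ae Q, forall w, exists n, Tm <= tau n w} &
        forall n, martingale Q Tm F
          (fun t w => stopped (tau n) X t w - X 0 w)].

(** * The market *)

(** Stochastic integration is not available, so the self-financing admissible
    trading strategies form an arbitrary type [strategy], with the value
    processes [wealth] they generate; they enter only through completeness. *)
Record market (R : realType) d (Om : measurableType d) (m : nat) := Market {
  horizon : R ;
  filt : R -> set (set Om) ;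
  bank : R -> Om -> R ;
  risky : 'I_m -> R -> Om -> R ;
  pricing : probability Om R ;
  strategy : Type ;
  wealth : strategy -> R -> Om -> R }.

Definition local_martingale_measure (R : realType) d (Om : measurableType d)
    (P : probability Om R) (m : nat) (M : market R Om m)
    (Q : probability Om R) : Prop :=
  [/\ Q `<< P, P `<< Q &
      forall i, local_martingale Q (horizon M) (filt M)
        (fun t w => risky M i t w / bank M t w)].

Definition state_price (R : realType) d (Om : measurableType d)
    (P : probability Om R) (m : nat) (M : market R Om m) : Om -> R :=
  fun w => bank M 0 w / bank M (horizon M) w
    * fine (Radon_Nikodym (charge_of_finite_measure (pricing M)) P w).

Definition replicable (R : realType) d (Om : measurableType d)
    (P : probability Om R) (m : nat) (M : market R Om m)
    (X : Om -> R) : Prop :=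
  exists theta : strategy M,
    {ae P, forall w, wealth theta (horizon M) w = X w}.

Record complete_market (R : realType) d (Om : measurableType d)
    (P : probability Om R) (m : nat) (M : market R Om m) : Prop := {
  horizon_gt0 : 0 < horizon M ;
  filt_filtration : filtration (horizon M) (filt M) ;
  bank_adapted : adapted (horizon M) (filt M) (bank M) ;
  bank_gt0 : forall (t : R) (w : Om), 0 <= t <= horizon M -> 0 < bank M t w ;
  risky_adapted : forall i, adapted (horizon M) (filt M) (risky M i) ;
  pricing_lmm : local_martingale_measure P M (pricing M) ;
  pricing_unique : forall Q : probability Om R,
    local_martingale_measure P M Q ->
    forall A, measurable A -> Q A = pricing M A ;
  complete : forall X : Om -> R, measurable_fun setT X ->
    (forall w, 0 <= X w) ->
    ('E_P[(fun w => state_price P M w * X w)%R] < +oo)%E ->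
    replicable P M X }.

Definition atomless_rv (R : realType) d (Om : measurableType d)
    (P : probability Om R) (xi : Om -> R) : Prop :=
  forall x, P [set w | xi w = x] = 0%E.

(** * Utility and the benchmark *)

(** Only the values of [U] on [[0, +oo[] matter. *)
Record utility (R : realType) (U : R -> R) : Prop := {
  utility_incr : forall x y : R, 0 <= x -> x < y -> U x < U y ;
  utility_concave : forall x y t : R, 0 <= x -> 0 <= y -> x != y -> 0 < t < 1 ->
    t * U x + (1 - t) * U y < U (t * x + (1 - t) * y) ;
  utility_derivable : forall x : R, 0 < x -> derivable U x 1 ;
  utility_C1 : forall x : R, 0 < x -> {for x, continuous (derive1 U)} ;
  utility_lbound : exists c, forall x : R, 0 <= x -> c <= U x ;
  utility0 : U 0 = 0 ;
  utility_inada0 : derive1 U x @[x --> 0^'+] --> +oo ;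
  utility_inada_oo : derive1 U x @[x --> +oo] --> 0 ;
  utility_elasticity :
    (limf_esup (fun x : R => (x * derive1 U x / U x)%:E) (+oo)%R < 1)%E }.

Definition tangency_point (R : realType) (U : R -> R) (D z : R) : Prop :=
  D < z /\ U (z - D) / z = derive1 U (z - D).

Definition inv_marginal (R : realType) (U : R -> R) (y : R) : R :=
  xget 0 [set x | 0 < x /\ derive1 U x = y].

Definition benchmark (R : realType) (Om : Type) (U : R -> R) (D Dh lamB : R)
    (xi : Om -> R) : Om -> R :=
  fun w => if xi w < derive1 U (Dh - D) / lamB
           then inv_marginal U (lamB * xi w) + D else 0.

(** * The optimization problems *)

Definition terminal_wealths (R : realType) d (Om : measurableType d)
    (P : probability Om R) (m : nat) (M : market R Om m) (x0 : R) :
    set (Om -> R) :=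
  [set X | [/\ measurable_fun setT X, replicable P M X,
               forall w, 0 <= X w &
               ('E_P[(fun w => state_price P M w * X w)%R] = x0%:E)%E]].

Definition exp_utility (R : realType) d (Om : measurableType d)
    (P : probability Om R) (U : R -> R) (D : R) (X : Om -> R) : \bar R :=
  'E_P[(fun w => U (Num.max (X w - D) 0))%R]%E.

Definition feasible (R : realType) d (Om : measurableType d)
    (P : probability Om R) (m : nat) (M : market R Om m) (x0 : R)
    (C : set (Om -> R)) (X : Om -> R) : Prop :=
  [/\ terminal_wealths P M x0 X,
      ('E_P[(fun w => state_price P M w * X w)%R] <= x0%:E)%E & C X].

(** A maximum is understood to be finite: if the value of the problem were
    [+oo], every feasible wealth of infinite expected utility would attain it. *)
Definition optimal (R : realType) d (Om : measurableType d)
    (P : probability Om R) (m : nat) (M : market R Om m) (U : R -> R)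
    (D x0 : R) (C : set (Om -> R)) (X : Om -> R) : Prop :=
  [/\ feasible P M x0 C X, (exp_utility P U D X < +oo)%E &
      forall Y, feasible P M x0 C Y ->
        (exp_utility P U D Y <= exp_utility P U D X)%E].

(** * The risk constraints *)

Definition ESQ (R : realType) d (Om : measurableType d)
    (P : probability Om R) (xi : Om -> R) (L eps : R) : set (Om -> R) :=
  [set X | 'E_P[(fun w => xi w * Num.max (L - X w) 0)%R] <= eps%:E]%E.

Definition ESP (R : realType) d (Om : measurableType d)
    (P : probability Om R) (L eps : R) : set (Om -> R) :=
  [set X | 'E_P[(fun w => Num.max (L - X w) 0)%R] <= eps%:E]%E.

Definition VaR (R : realType) d (Om : measurableType d)
    (P : probability Om R) (L alpha : R) : set (Om -> R) :=
  [set X | (1 - alpha)%:E <= P [set w | (L <= X w)%R]]%E.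

Definition value_at_risk (R : realType) d (Om : measurableType d)
    (P : probability Om R) (X : Om -> R) (beta : R) : \bar R :=
  ereal_sup [set x%:E | x in [set x : R |
    (P [set w | (X w < x)%R] <= beta%:E)%E]].

Definition AVaR (R : realType) d (Om : measurableType d)
    (P : probability Om R) (alpha LA : R) : set (Om -> R) :=
  [set X | (LA%:E <= (alpha^-1)%:E *
    \int[lebesgue_measure]_(beta in `[0%R, alpha]) value_at_risk P X beta)%E].

(* Main.v *)
Require Import Defs.
From mathcomp Require Import measurable_realfun ring lra.

Import Order.TTheory GRing.Theory Num.Theory.
Import numFieldNormedType.Exports.

Local Open Scope classical_set_scope.
Local Open Scope ring_scope.

Set Implicit Arguments.
Unset Strict Implicit.
Unset Printing Implicit Defensive.

(** Write [u y] for [U] of the positive part of [y - D], [xi] for the state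
price density, and [k = U'(Dh - D)] for the slope of the line through the
origin that touches [u], at [Dh].  If [0 < L <= Dh], then [u] lies below its
chord on [[0, L]] ([surplus_chord]).  A Lagrangian that penalizes the shortfall
below [L] linearly is therefore maximized over [[0, L]] at an end point: in each
state one either defaults completely or holds at least [L].  This is why the
different constraints at the level [L] lead to one and the same family of
wealths: hold nothing where [xi >= c], and where [xi < c] hold the maximizer of
[t u(y) - xi y] over [y >= L] ([cutoff_demand]).  The cutoff [c] is a quantile,
[P (xi < c) = 1 - a], and the weight [t] of utility, the inverse of the budget
multiplier, makes the wealth cost exactly [x0]; it exists because the cost
depends continuously on [t] and straddles [x0] between [t = 0] and the weight of
the benchmark ([exists_multiplier]).  The value [t = 0] does occur, namely when
the budget just pays for [L] in all states with [xi < c].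

With a multiplier that makes the two choices equally good at [xi = c], this
wealth maximizes the Lagrangian of the ESP problem strictly in almost every
state, so it is the only solution of that problem with the bound [L a] on the
shortfall ([shortfall_lagrangian_lt]).  Weighting the penalty by [xi] gives
optimality in the ESQ problem, with the bound [L E(xi; xi >= c)]; there the
maximizer is strict if [D < L].  For [t = 0] the ESQ problem needs a separate
argument, since the Lagrangian then ignores utility.  These facts are collected
in [exists_cutoff_solution].  A wealth that falls below [L] with probability at
most [a] has an expected shortfall of at most [L a], so the VaR problem is a
restriction of the ESP problem that still contains its solution, and has the
same unique solution.

The levels of the constraints are unique because a constraint cannot be slack at
an optimum: passing from [a] to a slightly larger [a'] gives a strictly better
wealth ([cutoff_improvement]) which would still be feasible.

For the AVaR problem the threshold [Ls] supplies an ESP problem with bound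
[alpha (Ls - LA)], and the default probability is [a = alpha (Ls - LA) / Ls].  It
is smaller than that of the benchmark: otherwise the value at risk of the
benchmark would be at least [Ls] at all levels above [a], and the benchmark would
satisfy the AVaR constraint ([AVaR_ge]). *)

(** * Marginal utility *)

Section marginal_utility.
Variables (R : realType) (U : R -> R).
Hypothesis hU : utility U.
Implicit Types x y z : R.

Lemma utility_le x y : 0 <= x -> x <= y -> U x <= U y.
Proof.
move=> x0; rewrite le_eqVlt => /predU1P[->//|xy].
exact/ltW/(utility_incr hU).
Qed.

Lemma utility_ge0 x : 0 <= x -> 0 <= U x.
Proof. by move=> x0; rewrite -(utility0 hU) utility_le. Qed.

Lemma utility_gt0 x : 0 < x -> 0 < U x.
Proof. by move=> x0; rewrite -(utility0 hU) (utility_incr hU). Qed.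

(** The chord from [x] towards [y] lies below the graph, so the
    increment along it is at most each difference quotient at [x] in that
    direction, hence at most the directional derivative. *)
Lemma tangent_le x y : 0 < x -> 0 <= y -> U y - U x <= derive1 U x * (y - x).
Proof.
move=> x0 y0; have [->|yx] := eqVneq y x; first by rewrite !subrr mulr0.
have yx0 : y - x != 0 by rewrite subr_eq0.
have dU : (fun h => h^-1 *: (U (h + x) - U x)) h @[h --> 0^'] --> derive1 U x.
  rewrite derive1E; have := utility_derivable hU x0; rewrite /derivable /derive.
  by under eq_fun do rewrite [_ *: 1]mulr1.
rewrite leNgt; apply/negP => gap.
pose e := (U y - U x - derive1 U x * (y - x)) / `|y - x|.
have n0 : 0 < `|y - x| by rewrite normr_gt0.
have e0 : 0 < e by rewrite divr_gt0// subr_gt0.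
move/cvgrPdist_lt : dU => /(_ e e0) /nbhs_ballP[r /= r0 Hr].
(* the step [t * (y - x)] stays in the ball of radius [r] where difference
   quotients are closer than [e] to the derivative *)
pose t := Num.min (1 / 2) (r / 2 / `|y - x|).
have t0 : 0 < t by rewrite lt_min !divr_gt0.
have t1 : t < 1 by rewrite gt_min; apply/orP; left; lra.
have tr : t * `|y - x| < r.
  rewrite (@le_lt_trans _ _ (r / 2))//; last lra.
  by rewrite -ler_pdivlMr// ge_min lexx orbT.
have := Hr (t * (y - x)).
rewrite /ball/= sub0r normrN normrM (gtr0_norm t0) => /(_ tr).
rewrite mulf_neq0// ?(gt_eqF t0)// => /(_ isT).
rewrite /e ltr_pdivlMr// -normrM -normrN => /(le_lt_trans (ler_norm _)).
rewrite ltNge => /negP; apply.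
have := utility_concave hU y0 (ltW x0) yx (t := t).
rewrite t0 t1 => /(_ isT) /ltW.
have -> : t * y + (1 - t) * x = t * (y - x) + x by ring.
move=> H.
have : U y - U x <= t^-1 * (U (t * (y - x) + x) - U x).
  by rewrite ler_pdivlMl//; lra.
rewrite /GRing.scale/= => H2.
have -> : - ((derive1 U x - (t * (y - x))^-1 * (U (t * (y - x) + x) - U x)) * (y - x))
  = t^-1 * (U (t * (y - x) + x) - U x) - derive1 U x * (y - x).
  by field; rewrite yx0 gt_eqF.
lra.
Qed.

(** Strictness comes from applying the weak inequality at the midpoint. *)
Lemma tangent_lt x y : 0 < x -> 0 <= y -> y != x ->
  U y < U x + derive1 U x * (y - x).
Proof.
move=> x0 y0 yx.
have h : 0 < (1/2 : R) < 1 by lra.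
have /= := utility_concave hU y0 (ltW x0) yx h.
have m0 : 0 <= 1 / 2 * y + (1 - 1 / 2) * x by lra.
have := tangent_le x0 m0.
have -> : 1 / 2 * y + (1 - 1 / 2) * x - x = (y - x) / 2 by field.
rewrite mulrA => H1 H2; lra.
Qed.

Lemma marginal_gt0 x : 0 < x -> 0 < derive1 U x.
Proof.
move=> x0; have := utility_incr hU (ltW x0) (_ : x < x + 1).
rewrite ltrDl ltr01 => /(_ isT).
have := @tangent_le x (x + 1) x0.
have -> : x + 1 - x = 1 by ring.
rewrite mulr1 => H H'.
have : 0 <= x + 1 by lra.
move/H; lra.
Qed.

Lemma marginal_decr x y : 0 < x -> x < y -> derive1 U y < derive1 U x.
Proof.
move=> x0 xy; have y0 : 0 < y by lra.
have := tangent_lt x0 (ltW y0) (negbT (gt_eqF xy)).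
have := tangent_lt y0 (ltW x0) (negbT (lt_eqF xy)).
move=> H1 H2.
have : 0 < (derive1 U x - derive1 U y) * (y - x) by nra.
rewrite pmulr_lgt0 ?subr_gt0//.
Qed.

Lemma marginal_le x y : 0 < x -> x <= y -> derive1 U y <= derive1 U x.
Proof.
by move=> x0; rewrite le_eqVlt => /predU1P[->//|xy]; exact/ltW/marginal_decr.
Qed.

Lemma marginal_surj z : 0 < z -> exists2 x, 0 < x & derive1 U x = z.
Proof.
move=> z0.
have [a [a0 za]] : exists a, 0 < a /\ z < derive1 U a.
  have /cvgryPgt/(_ z) := utility_inada0 hU => H.
  have F : \forall x \near 0^'+, 0 < x /\ z < derive1 U x.
    by near=> x; split=> //; near: x.
  by have [x] := filter_ex F; exists x.
have [b [b0 zb]] : exists b, a < b /\ derive1 U b < z.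
  have /cvgr_lt/(_ z z0) H := utility_inada_oo hU.
  have F : \forall x \near +oo, a < x /\ derive1 U x < z.
    near=> x; split; last by near: x.
    by near: x; apply: nbhs_pinfty_gt; rewrite num_real.
  by have [x] := filter_ex F; exists x.
have [| |c] := @IVT R (derive1 U) a b z (ltW b0).
- apply: continuous_in_subspaceT => x; rewrite inE/= in_itv/= => /andP[ax _].
  by apply: (utility_C1 hU); lra.
- by rewrite ge_min le_max (ltW za) (ltW zb) orbT.
by rewrite in_itv/= => /andP[ac _] <-; exists c => //; lra.
Unshelve. all: by end_near. Qed.

Lemma inv_marginalP z : 0 < z ->
  0 < inv_marginal U z /\ derive1 U (inv_marginal U z) = z.
Proof.
move=> z0; rewrite /inv_marginal; case: xgetP => [x -> []//|/= H].
by have [x x0 Ux] := marginal_surj z0; case: (H x).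
Qed.

(** Marginal utility is decreasing, so it separates a neighbourhood of [z] from
    the values it takes at distance [d] from the preimage of [z]. *)
Lemma inv_marginal_continuous z : 0 < z ->
  {for z, continuous (inv_marginal U)}.
Proof.
move=> z0; have [I0 Iz] := inv_marginalP z0.
apply/cvgrPdist_lt => e e0 /=.
pose d := Num.min e (inv_marginal U z / 2).
have d0 : 0 < d by rewrite lt_min e0 divr_gt0.
have de : d <= e by rewrite ge_min lexx.
have dI : d < inv_marginal U z by rewrite gt_min; apply/orP; right; lra.
have lo : derive1 U (inv_marginal U z + d) < z.
  by rewrite -[ltRHS]Iz marginal_decr// ltrDl.
have hi : z < derive1 U (inv_marginal U z - d).
  by rewrite -[ltLHS]Iz marginal_decr ?subr_gt0// ltrBlDr ltrDl.
near=> t.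
have t0 : 0 < t by near: t; exact: lt_nbhsr.
have tlo : derive1 U (inv_marginal U z + d) < t by near: t; exact: lt_nbhsr.
have thi : t < derive1 U (inv_marginal U z - d) by near: t; exact: lt_nbhsl.
have [It0 It] := inv_marginalP t0.
apply: lt_le_trans de; rewrite ltr_distlC; apply/andP; split.
- rewrite ltNge; apply/negP => /(marginal_le It0); rewrite It; lra.
- rewrite ltNge; apply/negP => /marginal_le; rewrite It.
  by move=> /(_ (addr_gt0 I0 d0)); lra.
Unshelve. all: by end_near. Qed.

End marginal_utility.

(** * Demand for wealth above a floor *)

Definition surplus_utility (R : realType) (U : R -> R) (D y : R) : R :=
  U (Num.max (y - D) 0).

Section surplus_utility.
Variables (R : realType) (U : R -> R) (D : R).
Hypothesis hU : utility U.
Implicit Types x y z : R.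
Local Notation u := (surplus_utility U D).
Local Notation J z := (inv_marginal U z + D).

Lemma surplus_utility_ge0 y : 0 <= u y.
Proof. by apply: (utility_ge0 hU); rewrite le_max lexx orbT. Qed.

Lemma surplus_utility_le x y : x <= y -> u x <= u y.
Proof.
move=> xy; apply: (utility_le hU); first by rewrite le_max lexx orbT.
by rewrite ge_max !le_max lexx orbT andbT lerB//.
Qed.

Lemma surplus_utility_below y : y <= D -> u y = 0.
Proof. by move=> yD; rewrite /surplus_utility max_r ?utility0// subr_le0. Qed.

Lemma surplus_utility_above y : D <= y -> u y = U (y - D).
Proof. by move=> Dy; rewrite /surplus_utility max_l// subr_ge0. Qed.

Lemma surplus_utility_gt0 y : D < y -> 0 < u y.
Proof.
by move=> Dy; rewrite surplus_utility_above ?ltW// utility_gt0// subr_gt0.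
Qed.

Lemma surplus_tangent_lt x y : D < x -> D <= y -> y != x ->
  u y < u x + derive1 U (x - D) * (y - x).
Proof.
move=> Dx Dy yx; rewrite (surplus_utility_above Dy).
rewrite (surplus_utility_above (ltW Dx)).
have -> : y - x = (y - D) - (x - D) by ring.
apply: (tangent_lt hU); rewrite ?subr_gt0 ?subr_ge0//.
by apply: contra yx => /eqP/addIr ->.
Qed.

(** Above the debt level the problem is concave, and [J z] solves the
    first-order condition. *)
Lemma surplus_interior z y : 0 < z -> D <= y -> y != J z ->
  u y - z * y < u (J z) - z * J z.
Proof.
move=> z0 Dy yJ; have [I0 Iz] := inv_marginalP hU z0.
have := surplus_tangent_lt (_ : D < J z) Dy yJ.
rewrite ltrDr I0 addrK Iz => /(_ isT); lra.
Qed.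

Lemma surplus_interior_le z y : 0 < z -> D <= y ->
  u y - z * y <= u (J z) - z * J z.
Proof.
move=> z0 Dy; have [->//|yJ] := eqVneq y (J z).
exact/ltW/surplus_interior.
Qed.

Section floor.
Variable L : R.

(** The utility of the surplus is not concave, but above a floor [L] it leaves
    only two candidates: the interior optimum and the floor itself. *)
Definition floor_demand z : R :=
  if [&& 0 < z, L <= J z & u L - z * L <= u (J z) - z * J z] then J z else L.
Local Notation A := floor_demand.

Definition is_floor_demand z y :=
  L <= y /\ forall y', L <= y' -> u y' - z * y' <= u y - z * y.

Definition unique_floor_demand z :=
  forall y, L <= y -> y != A z -> u y - z * y < u (A z) - z * A z.

Lemma floor_demand_ge z : L <= A z.
Proof. by rewrite /A; case: ifPn => // /and3P[]. Qed.

(** Marginal utility at the floor is already below the price [z]. *)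
Lemma floor_boundary z y : 0 < z -> J z < L -> L < y ->
  u y - z * y < u L - z * L.
Proof.
move=> z0 JL Ly; have [I0 Iz] := inv_marginalP hU z0.
have DL : D < L by lra.
have zL : derive1 U (L - D) < z.
  by rewrite -[ltRHS]Iz; apply: (marginal_decr hU) => //; lra.
have := surplus_tangent_lt DL (_ : D <= y) (_ : y != L).
rewrite gt_eqF// => /(_ _ isT) H.
have /H{}H : D <= y by lra.
nra.
Qed.

Lemma floor_below_debt z y : 0 < z -> L < y -> y <= D ->
  u y - z * y < u L - z * L.
Proof.
move=> z0 Ly yD; rewrite surplus_utility_below//.
have := surplus_utility_ge0 L; nra.
Qed.

Lemma floor_demandP z : 0 < z -> is_floor_demand z (A z).
Proof.
move=> z0; split; first exact: floor_demand_ge.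
move=> y Ly; rewrite /A z0/=; case: ifPn => [/andP[LJ SJ]|].
  have [yD|Dy] := ltP y D; last exact: surplus_interior_le.
  apply: le_trans SJ; move: Ly; rewrite le_eqVlt => /predU1P[->//|Ly].
  exact/ltW/floor_below_debt/ltW.
move: (Ly); rewrite le_eqVlt => /predU1P[->//|L_y].
rewrite negb_and -!ltNge => /orP[JL|SJ].
  exact/ltW/floor_boundary.
have [yD|Dy] := ltP y D; first exact/ltW/floor_below_debt/ltW.
exact/(le_trans _ (ltW SJ))/surplus_interior_le.
Qed.

Lemma is_floor_demand_cases z y : 0 < z -> is_floor_demand z y ->
  y = L \/ y = J z.
Proof.
move=> z0 [Ly ymax]; have [->|yJ] := eqVneq y (J z); first by right.
left; apply/eqP; move: Ly; rewrite le_eqVlt => /predU1P[->//|Ly].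
have [JL|LJ] := ltP (J z) L.
  by have := floor_boundary z0 JL Ly; rewrite ltNge ymax.
have [yD|Dy] := ltP y D.
  by have := floor_below_debt z0 Ly (ltW yD); rewrite ltNge ymax.
by have := surplus_interior z0 Dy yJ; rewrite ltNge ymax.
Qed.

(** Adding the two optimality conditions gives the monotonicity of demand. *)
Lemma is_floor_demand_le z z' y y' : z < z' ->
  is_floor_demand z y -> is_floor_demand z' y' -> y' <= y.
Proof.
move=> zz' [Ly /(_ y') H] [Ly' /(_ y) H'].
have := H Ly'; have := H' Ly => {H H'}.
move=> H1 H2; have : (z' - z) * (y' - y) <= 0 by lra.
by rewrite pmulr_rle0 ?subr_gt0// subr_le0.
Qed.

Lemma floor_demand_le z z' : 0 < z -> z <= z' -> A z' <= A z.
Proof.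
move=> z0; rewrite le_eqVlt => /predU1P[->//|zz'].
by apply: (is_floor_demand_le zz'); apply: floor_demandP; lra.
Qed.

Lemma not_unique_floor_demand z : 0 < z -> ~ unique_floor_demand z ->
  is_floor_demand z L /\ exists2 y, L < y & is_floor_demand z y.
Proof.
move=> z0 /existsNP[y /not_implyP[Ly /not_implyP[yA /negP]]].
rewrite -leNgt => ymax.
have dA := floor_demandP z0.
have dy : is_floor_demand z y.
  by split=> // y' /dA.2 /le_trans; apply.
have [AL|AL] := eqVneq (A z) L.
  split; first by rewrite -AL.
  by exists y => //; rewrite lt_neqAle Ly andbT eq_sym -AL.
split; last by exists (A z) => //; rewrite lt_neqAle eq_sym AL floor_demand_ge.
case: (is_floor_demand_cases z0 dA) => [/eqP|AJ]; first by rewrite (negbTE AL).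
case: (is_floor_demand_cases z0 dy) => [<-//|yJ].
by rewrite yJ AJ eqxx in yA.
Qed.

(** When the maximizer is not unique, both the floor and a larger wealth are
    maximizers.  As demand decreases with the price, this cannot happen at two
    prices. *)
Lemma unique_floor_demand_but_one :
  exists z0, forall z, 0 < z -> z != z0 -> unique_floor_demand z.
Proof.
have [[z1 [z10 n1]]|none] :=
    pselect (exists z1, 0 < z1 /\ ~ unique_floor_demand z1); last first.
  exists 0 => z z0 _; apply: contrapT => nz; apply: none; by exists z.
have [d1 [y1 Ly1 e1]] := not_unique_floor_demand z10 n1.
exists z1 => z z0 zz1; apply: contrapT => nz.
have [d [y Ly e]] := not_unique_floor_demand z0 nz.
case/orP : (lt_total zz1) => zz.
- by have := is_floor_demand_le zz d e1; rewrite leNgt Ly1.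
- by have := is_floor_demand_le zz d1 e; rewrite leNgt Ly.
Qed.

(** Where the maximizer is unique, the comparison between the two candidates has
    the same outcome at all nearby prices unless they coincide; so demand moves
    at most as much as the interior optimum, which is continuous. *)
Lemma floor_demand_continuous z : 0 < z -> unique_floor_demand z ->
  {for z, continuous A}.
Proof.
move=> z0 unq.
have cJ : J t @[t --> z] --> J z.
  by apply: cvgD; [exact: inv_marginal_continuous|exact: cvg_cst].
suff near_le : \forall t \near z, `|A z - A t| <= `|J z - J t|.
  apply/cvgrPdist_lt => e e0 /=; near=> t.
  apply: (@le_lt_trans _ _ `|J z - J t|); first by near: t.
  by near: t; move: e e0; exact/cvgrPdist_lt.
have AE t : 0 < t -> A t =
  if (L <= J t) && (u L - t * L <= u (J t) - t * J t) then J t else L.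
  by move=> t0; rewrite /A t0.
have [LJ|JL] := leP L (J z); last first.
  near=> t.
  have t0 : 0 < t by near: t; exact: lt_nbhsr.
  have JtL : J t < L by near: t; apply: cvgr_lt; [exact: cJ|].
  by rewrite !AE// [L <= J z]leNgt JL/= [L <= J t]leNgt JtL/= subrr normr0.
have [SJ|nSJ] := leP (u L - z * L) (u (J z) - z * J z).
  have AzJ : A z = J z by rewrite AE// LJ SJ.
  move: (LJ); rewrite le_eqVlt => /predU1P[LJz|LJz].
    near=> t.
    have t0 : 0 < t by near: t; exact: lt_nbhsr.
    by rewrite AzJ AE//; case: ifP => // _; rewrite -LJz subrr normr0.
  have := unq L (lexx _); rewrite AzJ (lt_eqF LJz) => /(_ isT) gap.
  near=> t.
  have t0 : 0 < t by near: t; exact: lt_nbhsr.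
  have LJt : L < J t by near: t; apply: cvgr_gt; [exact: cJ|].
  have tgap : (t - z) * (J z - L) < u (J z) - z * J z - (u L - z * L).
    near: t; apply: (@cvgr_lt _ _ _ _ _ ((z - z) * (J z - L))); last lra.
    by apply: cvgMl; apply: cvgB; [exact: cvg_id|exact: cvg_cst].
  rewrite AE// (ltW LJt)/=.
  have -> // : u L - t * L <= u (J t) - t * J t.
  apply: (@le_trans _ _ (u (J z) - t * J z)); last first.
    by apply: surplus_interior_le => //; have [] := inv_marginalP hU z0; lra.
  lra.
have AzL : A z = L by rewrite AE// [X in _ && X]leNgt nSJ andbF.
near=> t.
have t0 : 0 < t by near: t; exact: lt_nbhsr.
have tgap : (z - t) * (J t - L) < u L - z * L - (u (J z) - z * J z).
  near: t; apply: (@cvgr_lt _ _ _ _ _ ((z - z) * (J z - L))); last lra.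
  apply: cvgM; last by apply: cvgB; [exact: cJ|exact: cvg_cst].
  by apply: cvgB; [exact: cvg_cst|exact: cvg_id].
have := surplus_interior_le z0 (_ : D <= J t).
have [It0 _] := inv_marginalP hU t0.
rewrite lerDr (ltW It0) => /(_ isT) H.
rewrite AzL AE//.
rewrite [X in _ && X]leNgt.
have -> : u (J t) - t * J t < u L - t * L by lra.
by rewrite andbF subrr normr0.
Unshelve. all: by end_near. Qed.

(** Exceeding the floor gains a bounded amount of utility, at a price that tends
    to infinity. *)
Lemma floor_demand_cvg : A z @[z --> +oo] --> L.
Proof.
apply/cvgrPdist_lt => e e0 /=.
near=> z.
have z1 : 1 <= z by near: z; apply: nbhs_pinfty_ge; rewrite num_real.
have ze : u (A 1) / e < z by near: z; apply: nbhs_pinfty_gt; rewrite num_real.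
have z0 : 0 < z by lra.
have LA := floor_demand_ge z.
rewrite ler0_norm ?subr_le0// opprB.
have := (floor_demandP z0).2 L (lexx _).
have : u (A z) <= u (A 1) by apply: surplus_utility_le; exact: floor_demand_le.
have := surplus_utility_ge0 L.
move: ze; rewrite ltr_pdivrMr// => ze H1 H2 H3.
have : z * (A z - L) < z * e by lra.
by rewrite ltr_pM2l.
Unshelve. all: by end_near. Qed.

End floor.
End surplus_utility.

(** * Chords and tangents of the surplus utility *)

Section concavification.
Variables (R : realType) (U : R -> R) (D Dh : R).
Hypotheses (hU : utility U) (D0 : 0 < D) (hDh : tangency_point U D Dh).
Implicit Types x y z : R.
Local Notation u := (surplus_utility U D).
Local Notation J z := (inv_marginal U z + D).
Local Notation k := (derive1 U (Dh - D)).

Lemma tangency_slope_gt0 : 0 < k.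
Proof. by apply: marginal_gt0 => //; rewrite subr_gt0; case: hDh. Qed.

Lemma surplus_tangency : u Dh = k * Dh.
Proof.
have [DDh <-] := hDh.
rewrite (surplus_utility_above _ (ltW DDh)) divfK// gt_eqF//; exact: lt_trans DDh.
Qed.

(** By the choice of [Dh], the tangent at [Dh] passes through the origin. *)
Lemma surplus_le_tangent y : 0 <= y -> u y <= k * y.
Proof.
move=> y0; have [DDh _] := hDh; have k0 := tangency_slope_gt0.
have [yD|Dy] := ltP y D.
  by rewrite (surplus_utility_below hU (ltW yD)) mulr_ge0// ltW.
have [->|yDh] := eqVneq y Dh; first by rewrite surplus_tangency.
have := surplus_tangent_lt hU DDh Dy yDh.
rewrite surplus_tangency => H; lra.
Qed.

(** Equivalently, [u y / y] increases up to [Dh]: concavity puts [u L] above the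
    segment from [y] to [Dh], and [u Dh = k Dh] is large because [u y <= k y]. *)
Lemma surplus_chord L y : 0 <= y -> y <= L -> L <= Dh -> u y * L <= u L * y.
Proof.
move=> y0 yL LDh; have uy := surplus_le_tangent y0.
have [yD|Dy] := leP y D.
  by rewrite (surplus_utility_below hU yD) mul0r mulr_ge0// surplus_utility_ge0.
move: (yL); rewrite le_eqVlt => /predU1P[->//|y_L].
move: (LDh); rewrite le_eqVlt => /predU1P[->|L_Dh].
  by rewrite surplus_tangency; nra.
have yDh : y < Dh by lra.
pose s := (Dh - L) / (Dh - y).
have sy : s * (Dh - y) = Dh - L by rewrite /s divfK// gt_eqF// subr_gt0.
have s01 : 0 < s < 1.
  by rewrite divr_gt0 ?subr_gt0//= ltr_pdivrMr ?subr_gt0//; lra.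
have := utility_concave hU (_ : 0 <= y - D) (_ : 0 <= Dh - D)
  (_ : y - D != Dh - D) s01.
have -> : s * (y - D) + (1 - s) * (Dh - D) = L - D by lra.
rewrite !subr_ge0 (ltW Dy).
have DDh : D <= Dh by lra.
have ne : y - D != Dh - D by rewrite lt_eqF// ltrD2r.
rewrite DDh => /(_ isT isT ne) /ltW.
have DL : D <= L by lra.
rewrite -!surplus_utility_above ?(ltW Dy)// surplus_tangency.
move=> H.
have y_gt0 : 0 < y := lt_trans D0 Dy.
case/andP: s01 => s0 s1.
have : s * (u y * y) + (1 - s) * (u y * Dh) <= u L * y.
  apply: (@le_trans _ _ ((s * u y + (1 - s) * (k * Dh)) * y)).
    have -> : (s * u y + (1 - s) * (k * Dh)) * y =
      s * (u y * y) + (1 - s) * (k * y * Dh) by ring.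
    rewrite lerD2l ler_wpM2l ?subr_ge0 ?(ltW s1)//.
    by rewrite ler_wpM2r// (le_trans (ltW D0)).
  by rewrite ler_wpM2r// ltW.
have -> // : s * (u y * y) + (1 - s) * (u y * Dh) = u y * (Dh - s * (Dh - y)).
  by ring.
by rewrite sy; have -> : Dh - (Dh - L) = L by ring.
Qed.

(** At prices below the tangency slope, the interior optimum beats all wealths,
    including those below the debt level. *)
Lemma benchmark_demand z y : 0 < z -> z < k -> 0 <= y -> y != J z ->
  u y - z * y < u (J z) - z * J z.
Proof.
move=> z0 zk y0 yJ; have [DDh _] := hDh.
have [yD|Dy] := leP y D; last exact: (surplus_interior hU z0 (ltW Dy)).
rewrite (surplus_utility_below hU yD).
have := surplus_interior_le hU z0 (ltW DDh).
rewrite surplus_tangency; nra.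
Qed.

Lemma benchmark_demand_ge z : 0 < z -> z < k -> Dh <= J z.
Proof.
move=> z0 zk; have [DDh _] := hDh; have [I0 Iz] := inv_marginalP hU z0.
rewrite leNgt; apply/negP => JDh.
have := marginal_decr hU I0 (_ : inv_marginal U z < Dh - D).
rewrite Iz => H; have /H : inv_marginal U z < Dh - D by lra.
lra.
Qed.

Lemma floor_demand_benchmark L z : 0 <= L -> L <= Dh -> 0 < z -> z < k ->
  floor_demand U D L z = J z.
Proof.
move=> L0 LDh z0 zk; apply/eqP/negPn/negP => /(benchmark_demand z0 zk) H.
have LA := floor_demand_ge U D L z.
have := (floor_demandP D hU L z0).2 (J z).
have JDh := benchmark_demand_ge z0 zk.
move=> /(_ (le_trans LDh JDh)); rewrite leNgt => /negP; apply.
by apply: H; lra.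
Qed.

End concavification.

(** * The cutoff wealth and its Lagrangians *)

Section scaled_demand.
Variables (R : realType) (U : R -> R) (D L : R).
Hypothesis hU : utility U.
Implicit Types t x y : R.
Local Notation u := (surplus_utility U D).

(** Putting the weight [t] on utility rather than a multiplier on the cost turns
    an infinite multiplier into the regular parameter [t = 0]. *)
Definition scaled_demand t x : R :=
  if 0 < t then floor_demand U D L (x / t) else L.
Local Notation B := scaled_demand.

Lemma scaled_demand_ge t x : L <= B t x.
Proof. by rewrite /B; case: ifP => // _; exact: floor_demand_ge. Qed.

Lemma scaled_demandP t x y : 0 <= t -> 0 < x -> L <= y ->
  t * u y - x * y <= t * u (B t x) - x * B t x.
Proof.
move=> t0 x0 Ly; rewrite /B; case: ltP => t_0.
  have tE w : t * (x / t * w) = x * w by field; rewrite gt_eqF.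
  have := (floor_demandP D hU L (divr_gt0 x0 t_0)).2 _ Ly.
  by rewrite -(ler_pM2l t_0) !mulrBr !tE.
have -> : t = 0 by apply/eqP; rewrite eq_le t0 t_0.
by rewrite !mul0r !sub0r lerN2 ler_pM2l.
Qed.

(** The exceptional prices form a half-line in the plane of [t] and [x], so for
    fixed [t] there is at most one exceptional state price. *)
Lemma scaled_demand_lt :
  exists z0, forall t x y, 0 <= t -> 0 < x -> x != t * z0 -> L <= y ->
  y != B t x -> t * u y - x * y < t * u (B t x) - x * B t x.
Proof.
have [z0 Hz0] := unique_floor_demand_but_one D hU L.
exists z0 => t x y t0 x0 xtz Ly; rewrite /B; case: ltP => t_0.
  move=> yB; have := Hz0 (x / t) (divr_gt0 x0 t_0) _ _ Ly yB.
  have tE w : t * (x / t * w) = x * w by field; rewrite gt_eqF.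
  rewrite -(ltr_pM2l t_0) !mulrBr !tE.
  apply; apply: contra xtz => /eqP <-.
  by rewrite mulrC divfK// gt_eqF.
have -> : t = 0 by apply/eqP; rewrite eq_le t0 t_0.
by move=> yL; rewrite !mul0r !sub0r ltrN2 ltr_pM2l// lt_neqAle eq_sym yL.
Qed.

Lemma scaled_demand_le t x x' : 0 < x -> x <= x' -> B t x' <= B t x.
Proof.
move=> x0 xx'; rewrite /B; case: ifP => // t0.
by apply: floor_demand_le; rewrite ?divr_gt0// ler_pM2r ?invr_gt0.
Qed.

Lemma scaled_demand_le_floor t s x : 0 < s -> t <= s -> 0 < x ->
  B t x <= floor_demand U D L (x / s).
Proof.
move=> s0 ts x0; rewrite /B; case: ltP => t0; last exact: floor_demand_ge.
by apply: floor_demand_le; rewrite ?divr_gt0// ler_pM2l// lef_pV2.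
Qed.

(** At [t = 0] continuity is the limit of demand at infinite prices. *)
Lemma scaled_demand_continuous :
  exists z0, forall t x, 0 < x -> x != t * z0 -> {for t, continuous (B^~ x)}.
Proof.
have [z0 Hz0] := unique_floor_demand_but_one D hU L.
exists z0 => t x x0 xtz; have [t0|t0|->] := ltgtP t 0.
- apply: (@near_cst_continuous _ _ L).
  near=> s; have s0 : s < 0 by near: s; exact: lt_nbhsl.
  by rewrite /B ltNge (ltW s0).
- have xt : x / t != z0.
    by apply: contra xtz => /eqP <-; rewrite mulrC divfK// gt_eqF.
  have xt0 := divr_gt0 x0 t0.
  have cA := floor_demand_continuous hU xt0 (Hz0 _ xt0 xt).
  have Bt : B t x = floor_demand U D L (x / t) by rewrite /B t0.
  suff: B s x @[s --> t] --> B t x by []; rewrite Bt.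
  have H : floor_demand U D L (x / s) @[s --> t] --> floor_demand U D L (x / t).
    apply: (@cvg_comp _ _ _ (fun s => x / s) (floor_demand U D L) _ (nbhs (x / t))).
      apply: cvgM; first exact: cvg_cst.
      by apply: cvgV; [rewrite gt_eqF|exact: cvg_id].
    exact: cA.
  apply: cvg_trans H; apply: near_eq_cvg; near=> s.
  have s0 : 0 < s by near: s; exact: lt_nbhsr.
  by rewrite /B s0.
- have /cvgrPdist_lt cA := floor_demand_cvg D hU (L := L).
  have B0 : B 0 x = L by rewrite /B ltxx.
  suff: B s x @[s --> 0] --> B 0 x by [].
  rewrite B0; apply/cvgrPdist_lt => e e0 /=.
  have [M [_ HM]] := cA e e0.
  have M0 : 0 < Num.max M 1 by rewrite lt_max ltr01 orbT.
  have xM : 0 < x / Num.max M 1 by rewrite divr_gt0.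
  near=> s; rewrite /B; case: (ltP 0 s) => s0; last by rewrite subrr normr0.
  apply: HM; rewrite ltr_pdivlMr//.
  have : s < x / Num.max M 1 by near: s; exact: lt_nbhsl.
  rewrite ltr_pdivlMr// mulrC; apply: le_lt_trans.
  by rewrite ler_pM2r// le_max lexx.
Unshelve. all: by end_near. Qed.

End scaled_demand.

Section pointwise_lagrangian.
Variables (R : realType) (U : R -> R) (D Dh L : R).
Hypotheses (hU : utility U) (D0 : 0 < D) (hDh : tangency_point U D Dh).
Hypotheses (L0 : 0 < L) (LDh : L <= Dh).
Variables (t c : R).
Hypotheses (t0 : 0 <= t) (c0 : 0 < c).
Hypothesis (tkc : t * derive1 U (Dh - D) <= c).
Implicit Types x y : R.
Local Notation u := (surplus_utility U D).
Local Notation B := (scaled_demand U D L).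

Definition cutoff_demand x := if x < c then B t x else 0.

(** The penalty per unit of shortfall for which, at the state price [c],
    defaulting is exactly as good as the best wealth above [L]. *)
Definition cutoff_multiplier := - (t * u (B t c) - c * B t c) / L.
Local Notation mu := cutoff_multiplier.

Lemma cutoff_multiplierE : t * u (B t c) - c * B t c = - (mu * L).
Proof. by rewrite /mu divfK ?gt_eqF// opprK. Qed.

(** At the state price [c] no wealth beats holding nothing, by the tangent
    through the origin. *)
Lemma cutoff_multiplier_ge0 : 0 <= mu.
Proof.
rewrite divr_ge0 ?(ltW L0)// oppr_ge0 subr_le0.
have LB := scaled_demand_ge U D L t c.
have B0 : 0 <= B t c := le_trans (ltW L0) LB.
have := surplus_le_tangent hU D0 hDh B0; have := tkc; have := t0; nra.
Qed.

Lemma cutoff_demand_ge0 x : 0 <= cutoff_demand x.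
Proof.
rewrite /cutoff_demand; case: ifP => // _.
exact: le_trans (ltW L0) (scaled_demand_ge _ _ _ _ _).
Qed.

Lemma shortfall_cutoff x :
  Num.max (L - cutoff_demand x) 0 = if x < c then 0 else L.
Proof.
rewrite /cutoff_demand; case: ifP => _; last by rewrite subr0 max_l// ltW.
by rewrite max_r// subr_le0 scaled_demand_ge.
Qed.

Lemma shortfall_below y : y <= L -> Num.max (L - y) 0 = L - y.
Proof. by move=> yL; rewrite max_l// subr_ge0. Qed.

Lemma shortfall_above y : L <= y -> Num.max (L - y) 0 = 0.
Proof. by move=> yL; rewrite max_r// subr_le0. Qed.

Lemma chord_le x y : 0 <= y -> y <= L ->
  (t * u y - x * y) * L <= (t * u L - x * L) * y.
Proof.
move=> y0 yL; have := surplus_chord hU D0 hDh y0 yL LDh; have := t0.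
nra.
Qed.

(** On [[0, L]] the chord bounds the Lagrangian by an affine function of [y].
    It is thus enough to compare default, of value [- p L], with the wealths
    above [L]; for [x < c] the latter must win and for [c <= x] the former. *)
Lemma cutoff_lagrangian_le x p y : 0 < x -> 0 <= y ->
  (x < c -> - (p * L) <= t * u (B t x) - x * B t x) ->
  (c <= x -> forall y', L <= y' -> t * u y' - x * y' <= - (p * L)) ->
  t * u y - x * y - p * Num.max (L - y) 0 <=
  t * u (cutoff_demand x) - x * cutoff_demand x
    - p * Num.max (L - cutoff_demand x) 0.
Proof.
move=> x0 y0 Hlo Hhi; rewrite shortfall_cutoff /cutoff_demand.
case: ltP => xc.
  have {Hlo Hhi}Vx := Hlo xc.
  have [Ly|yL] := leP L y.
    by rewrite shortfall_above// !mulr0 !subr0; exact: scaled_demandP.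
  rewrite (shortfall_below (ltW yL)) mulr0 subr0.
  have := chord_le x y0 (ltW yL).
  have := scaled_demandP D hU (L := L) t0 x0 (lexx L).
  rewrite -(ler_pM2r L0) => H1 H2.
  set V := t * u (B t x) - x * B t x in Vx H1 *.
  have : (t * u L - x * L) * y <= V * y by rewrite ler_wpM2r//; nra.
  have : (L - y) * (- (p * L)) <= (L - y) * V.
    by rewrite ler_wpM2l// subr_ge0 ltW.
  nra.
have {Hlo Hhi}Vx := Hhi xc.
have u0 : u 0 = 0 by rewrite surplus_utility_below// ltW.
rewrite u0 !mulr0 subr0 sub0r.
have [Ly|yL] := leP L y.
  by rewrite shortfall_above// mulr0 subr0 Vx.
rewrite (shortfall_below (ltW yL)).
have := chord_le x y0 (ltW yL).
have : (t * u L - x * L) * y <= - (p * L) * y by rewrite ler_wpM2r// Vx.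
nra.
Qed.

Lemma cutoff_lagrangian_lt : exists z0, forall x p y,
  0 < x -> x != t * z0 -> 0 <= y -> y != cutoff_demand x ->
  (x < c -> - (p * L) < t * u (B t x) - x * B t x) ->
  (c <= x -> forall y', L <= y' -> t * u y' - x * y' < - (p * L)) ->
  t * u y - x * y - p * Num.max (L - y) 0 <
  t * u (cutoff_demand x) - x * cutoff_demand x
    - p * Num.max (L - cutoff_demand x) 0.
Proof.
have [z0 Hz0] := scaled_demand_lt D L hU.
exists z0 => x p y x0 xz y0 + Hlo Hhi; rewrite shortfall_cutoff /cutoff_demand.
case: ltP => xc yX.
  have {Hlo Hhi}Vx := Hlo xc.
  have [Ly|yL] := leP L y.
    by rewrite shortfall_above// !mulr0 !subr0; exact: Hz0.
  rewrite (shortfall_below (ltW yL)) mulr0 subr0.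
  have := chord_le x y0 (ltW yL).
  have H1 := scaled_demandP D hU (L := L) t0 x0 (lexx L).
  set V := t * u (B t x) - x * B t x in Vx H1 *.
  have : (t * u L - x * L) * y <= V * y by rewrite ler_wpM2r.
  have : (L - y) * (- (p * L)) < (L - y) * V by rewrite ltr_pM2l ?subr_gt0.
  move=> H2 H3 H4; rewrite -(ltr_pM2r L0); lra.
have {Hlo Hhi}Vx := Hhi xc.
have u0 : u 0 = 0 by rewrite surplus_utility_below// ltW.
rewrite u0 !mulr0 subr0 sub0r.
have [Ly|yL] := leP L y.
  by rewrite shortfall_above// mulr0 subr0 Vx.
rewrite (shortfall_below (ltW yL)).
have y_gt0 : 0 < y by rewrite lt_neqAle eq_sym yX.
have := chord_le x y0 (ltW yL).
have : (t * u L - x * L) * y < - (p * L) * y by rewrite ltr_pM2r// Vx.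
move=> H1 H2; rewrite -(ltr_pM2r L0); lra.
Qed.

(** The value of the best wealth above [L] decreases strictly with the state
    price, while that of defaulting is constant, and they agree at [c]. *)
Lemma shortfall_lagrangian_lt :
  exists z0, forall x y, 0 < x -> x != c -> x != t * z0 -> 0 <= y ->
    y != cutoff_demand x ->
    t * u y - x * y - mu * Num.max (L - y) 0 <
    t * u (cutoff_demand x) - x * cutoff_demand x
      - mu * Num.max (L - cutoff_demand x) 0.
Proof.
have [z0 Hz0] := cutoff_lagrangian_lt; exists z0 => x y x0 xc xz y0 yX.
have LBc := scaled_demand_ge U D L t c.
apply: Hz0 => //; rewrite -cutoff_multiplierE.
- move=> x_c; apply: (@lt_le_trans _ _ (t * u (B t c) - x * B t c)).
    by rewrite ltrD2l ltrN2 ltr_pM2r// (lt_le_trans L0).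
  exact: scaled_demandP.
- move=> cx y' Ly'; apply: (@lt_le_trans _ _ (t * u y' - c * y')).
    by rewrite ltrD2l ltrN2 ltr_pM2r ?(lt_le_trans L0)// lt_neqAle eq_sym xc.
  exact: scaled_demandP.
Qed.

(** Here the value of defaulting scales with [x], as does the cost of wealth, but
    utility does not: below [c] it counts for more than its share [x / c] in the
    comparison made at [c], above [c] for less. *)
Lemma weighted_shortfall_lagrangian_le x y : 0 < x -> 0 <= y ->
  t * u y - x * y - mu / c * x * Num.max (L - y) 0 <=
  t * u (cutoff_demand x) - x * cutoff_demand x
    - mu / c * x * Num.max (L - cutoff_demand x) 0.
Proof.
move=> x0 y0.
have LBc := scaled_demand_ge U D L t c.
have pE : mu / c * x * L = x / c * (mu * L) by ring.
have rE s v : x / c * (s - c * v) = x / c * s - x * v.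
  by field; rewrite gt_eqF.
have tu0 w : 0 <= t * u w by rewrite mulr_ge0// surplus_utility_ge0.
have r0 : 0 <= x / c by rewrite divr_ge0// ltW.
apply: cutoff_lagrangian_le => //; rewrite pE -mulrN -cutoff_multiplierE.
- move=> xc; apply: (@le_trans _ _ (t * u (B t c) - x * B t c)).
    rewrite rE lerD2r ler_piMl//.
    by rewrite ler_pdivrMr// mul1r ltW.
  exact: scaled_demandP.
- move=> cx y' Ly'; apply: (@le_trans _ _ (x / c * (t * u y' - c * y'))).
    rewrite rE lerD2r ler_peMl//.
    by rewrite ler_pdivlMr// mul1r.
  by rewrite ler_wpM2l//; exact: scaled_demandP.
Qed.

(** The comparison is strict as soon as the wealths above [L] have positive
    utility. *)
Lemma weighted_shortfall_lagrangian_lt : 0 < t -> D < L ->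
  exists z0, forall x y, 0 < x -> x != c -> x != t * z0 -> 0 <= y ->
    y != cutoff_demand x ->
    t * u y - x * y - mu / c * x * Num.max (L - y) 0 <
    t * u (cutoff_demand x) - x * cutoff_demand x
      - mu / c * x * Num.max (L - cutoff_demand x) 0.
Proof.
move=> t_gt0 DL.
have [z0 Hz0] := cutoff_lagrangian_lt; exists z0 => x y x0 xc xz y0 yX.
have LBc := scaled_demand_ge U D L t c.
have pE : mu / c * x * L = x / c * (mu * L) by ring.
have rE s v : x / c * (s - c * v) = x / c * s - x * v.
  by field; rewrite gt_eqF.
have tu0 w : L <= w -> 0 < t * u w.
  by move=> Lw; rewrite mulr_gt0// surplus_utility_gt0//; lra.
have r0 : 0 < x / c by rewrite divr_gt0.
apply: Hz0 => //; rewrite pE -mulrN -cutoff_multiplierE.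
- move=> x_c; apply: (@lt_le_trans _ _ (t * u (B t c) - x * B t c)).
    rewrite rE ltrD2r gtr_pMl ?tu0 ?scaled_demand_ge//.
    by rewrite ltr_pdivrMr// mul1r.
  exact: scaled_demandP.
- move=> cx y' Ly'; apply: (@lt_le_trans _ _ (x / c * (t * u y' - c * y'))).
    rewrite rE ltrD2r ltr_pMl ?tu0//.
    by rewrite ltr_pdivlMr// mul1r lt_neqAle eq_sym xc.
  by rewrite ler_pM2l//; exact: scaled_demandP.
Qed.

End pointwise_lagrangian.

(** * Integration up to null sets *)

Section integrable_functions.
Variables (R : realType) (d : measure_display) (Om : measurableType d).
Variable P : probability Om R.
Implicit Types f g : Om -> R.
Local Notation intg f := (P.-integrable setT (EFin \o (f : Om -> R))).
Local Notation mean f := (\int[P]_w (f : Om -> R) w)%R.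

Lemma expectationE f : 'E_P[f]%E = (\int[P]_w (f w)%:E)%E.
Proof. by rewrite unlock. Qed.

Lemma integrable_measurable f : intg f -> measurable_fun setT f.
Proof. by move=> /measurable_int/measurable_EFinP. Qed.

Lemma expectation_mean f : intg f -> 'E_P[f]%E = (mean f)%:E.
Proof.
move=> fi; rewrite expectationE /Rintegral fineK//.
exact: integrable_fin_num.
Qed.

Lemma expectation_ae_eq f g : measurable_fun setT f -> measurable_fun setT g ->
  {ae P, forall w, f w = g w} -> 'E_P[f]%E = 'E_P[g]%E.
Proof.
move=> mf mg fg; rewrite !expectationE; apply: ae_eq_integral => //.
- exact/measurable_EFinP.
- exact/measurable_EFinP.
- by apply: filterS fg => w /= -> .
Qed.

Lemma mean_ae_eq f g : measurable_fun setT f -> measurable_fun setT g ->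
  {ae P, forall w, f w = g w} -> mean f = mean g.
Proof.
move=> mf mg fg; rewrite /Rintegral; congr fine.
by have := expectation_ae_eq mf mg fg; rewrite !expectationE.
Qed.

Lemma integrable_ae_eq f g : measurable_fun setT g ->
  {ae P, forall w, f w = g w} -> intg f -> intg g.
Proof.
move=> mg fg fi; have mf := integrable_measurable fi.
apply/integrableP; split; first exact/measurable_EFinP.
case/integrableP : fi => _; congr (_ < _)%E.
apply: ae_eq_integral => //.
- by apply/measurable_EFinP; exact: measurableT_comp.
- by apply/measurable_EFinP; exact: measurableT_comp.
- by apply: filterS fg => w /= -> .
Qed.

Lemma integrable_ae_ge0 f : measurable_fun setT f ->
  {ae P, forall w, 0 <= f w} -> ('E_P[f] < +oo)%E -> intg f.
Proof.
move=> mf f0; rewrite expectationE => foo.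
apply/integrableP; split; first exact/measurable_EFinP.
move: foo; congr (_ < _)%E; apply: ae_eq_integral => //.
- exact/measurable_EFinP.
- by apply/measurable_EFinP; exact: measurableT_comp.
- by apply: filterS f0 => w /= f0 _; rewrite ger0_norm.
Qed.

Lemma integrable_ae_bound f g : measurable_fun setT f ->
  {ae P, forall w, `|f w| <= g w} -> intg g -> intg f.
Proof.
move=> mf fg gi; have mg := integrable_measurable gi.
pose h w := Num.max (- g w) (Num.min (f w) (g w)).
have mh : measurable_fun setT h.
  by apply: measurable_maxr; [exact: measurableT_comp|exact: measurable_minr].
apply: (@integrable_ae_eq h) => //.
  apply: filterS fg => w; rewrite /h ler_norml => /andP[gf fg].
  by rewrite (min_l fg) max_r.
apply: le_integrable gi => //; first exact/measurable_EFinP.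
move=> w _ /=; rewrite lee_fin /h ler_norml.
have := ler_norm (g w); have := ler_norm (- g w); rewrite normrN => H1 H2.
by rewrite ge_max le_max ge_min lerNl; apply/andP; split;
  [apply/orP; left; lra| apply/andP; split; [lra|apply/orP; right; lra]].
Qed.

Lemma integrableDr f g : intg f -> intg g -> intg (fun w => f w + g w).
Proof.
by move=> fi gi; apply: eq_integrable (integrableD _ fi gi).
Qed.

Lemma integrableBr f g : intg f -> intg g -> intg (fun w => f w - g w).
Proof.
by move=> fi gi; apply: eq_integrable (integrableB _ fi gi).
Qed.

Lemma integrableZr (r : R) f : intg f -> intg (fun w => r * f w).
Proof.
by move=> fi; apply: eq_integrable (integrableZl _ r fi).
Qed.

Lemma ae_le_mean f g : intg f -> intg g ->
  {ae P, forall w, f w <= g w} -> mean f <= mean g.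
Proof.
move=> fi gi fg; have mf := integrable_measurable fi.
have mg := integrable_measurable gi.
have mh : measurable_fun setT (fun w => Num.max (f w) (g w)).
  exact: measurable_maxr.
have gh : {ae P, forall w, g w = Num.max (f w) (g w)}.
  by apply: filterS fg => w /max_r ->.
rewrite (mean_ae_eq mg mh gh); apply: le_Rintegral => //.
- exact: integrable_ae_eq gi.
- by move=> w _; rewrite le_max lexx.
Qed.

Lemma ae_eq_of_mean_le f g : intg f -> intg g ->
  {ae P, forall w, f w <= g w} -> mean g <= mean f ->
  {ae P, forall w, f w = g w}.
Proof.
move=> fi gi fg gf.
have hi := integrableBr gi fi.
have mh := integrable_measurable hi.
have h0 : {ae P, forall w, 0 <= g w - f w}.
  by apply: filterS fg => w; rewrite subr_ge0.
have : (\int[P]_w `|(g w - f w)%:E| = 0)%E.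
  transitivity (\int[P]_w (g w - f w)%:E)%E.
    apply: ae_eq_integral => //.
    - by apply/measurable_EFinP; exact: measurableT_comp.
    - exact/measurable_EFinP.
    - by apply: filterS h0 => w /= h0 _; rewrite ger0_norm.
  have := expectation_mean hi; rewrite expectationE => ->.
  rewrite RintegralB//; congr EFin; apply/eqP.
  by rewrite subr_eq0 eq_le gf ae_le_mean.
move/(ae_eq_integral_abs _ measurableT _).1.
have mh' : measurable_fun setT (fun w => (g w - f w)%:E) by exact/measurable_EFinP.
move=> /(_ mh'); apply: filterS => w /= /(_ I) [] /eqP.
by rewrite subr_eq0 => /eqP.
Qed.

Lemma mean_cst (r : R) : (\int[P]_w r)%R = r.
Proof. by rewrite /Rintegral integral_cst//= probability_setT mule1. Qed.

Lemma mean_indic (A : set Om) : measurable A -> mean (\1_A) = fine (P A).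
Proof. by move=> mA; rewrite /Rintegral integral_indic// setIT. Qed.

Lemma measurable_lt_set f (c : R) : measurable_fun setT f ->
  measurable [set w | f w < c].
Proof.
move=> mf; rewrite -[X in measurable X]setTI.
have -> : [set w | f w < c] = f @^-1` `]-oo, c[.
  by apply/seteqP; split=> w /=; rewrite in_itv.
exact: mf.
Qed.

Lemma ge_setE f (c : R) : [set w | c <= f w] = ~` [set w | f w < c].
Proof. by apply/seteqP; split=> w /=; rewrite leNgt => /negP. Qed.

Lemma measurable_ge_set f (c : R) : measurable_fun setT f ->
  measurable [set w | c <= f w].
Proof. by move=> mf; rewrite ge_setE; exact/measurableC/measurable_lt_set. Qed.

Lemma indic_lt_set f (c : R) w :
  \1_[set w | f w < c] w = (f w < c)%R%:R :> R.
Proof.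
rewrite indicE; congr (_%:R); congr nat_of_bool.
by apply/idP/idP => [/set_mem|/mem_set].
Qed.

Lemma indic_ge_set f (c : R) w :
  \1_[set w | c <= f w] w = (c <= f w)%R%:R :> R.
Proof.
rewrite indicE; congr (_%:R); congr nat_of_bool.
by apply/idP/idP => [/set_mem|/mem_set].
Qed.

Lemma integrable_indic (A : set Om) : measurable A -> intg (\1_A).
Proof.
move=> mA; apply: (@integrable_ae_bound _ (cst 1)).
- exact: measurable_indic.
- by apply: aeW => w; rewrite indicE; case: (w \in A); rewrite ?normr1 ?normr0/=.
- exact: finite_measure_integrable_cst.
Qed.

Lemma integrable_indic_mul f (A : set Om) : measurable A -> intg f ->
  intg (fun w => \1_A w * f w).
Proof.
move=> mA fi; have mf := integrable_measurable fi.
apply: le_integrable fi => //.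
  by apply/measurable_EFinP; apply: measurable_funM => //; exact: measurable_indic.
move=> w _ /=; rewrite lee_fin normrM ler_piMl//.
by rewrite indicE; case: (_ \in _); rewrite ?normr1 ?normr0.
Qed.

Lemma probability_ae_le (A B : set Om) : measurable A -> measurable B ->
  {ae P, forall w, A w -> B w} -> (P A <= P B)%E.
Proof.
move=> mA mB AB.
rewrite -(setIT A) -(setIT B) -!integral_indic//.
apply: ae_ge0_le_integral => //.
- by apply/measurable_EFinP; exact: measurable_indic.
- by apply/measurable_EFinP; exact: measurable_indic.
apply: filterS AB => w AB _; rewrite lee_fin !indicE.
have [/set_mem/AB/mem_set -> //|_] := boolP (w \in A).
by rewrite ler0n.
Qed.

Lemma probability_ae_eq (A B : set Om) : measurable A -> measurable B ->
  {ae P, forall w, A w <-> B w} -> P A = P B.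
Proof.
move=> mA mB AB; apply/eqP; rewrite eq_le !probability_ae_le//.
- by apply: filterS AB => w [].
- by apply: filterS AB => w [].
Qed.

Lemma ae_neq f (x : R) : measurable_fun setT f ->
  P [set w | f w = x] = 0%E -> {ae P, forall w, f w != x}.
Proof.
move=> mf f0; exists [set w | f w = x]; split => //.
  by rewrite -[X in measurable X]setTI; exact: (mf measurableT [set x]).
by move=> w /= /negP; rewrite negbK => /eqP.
Qed.

(** Dominated convergence at a single point: only almost every section needs
    to be continuous there, as in the case of a moving threshold. *)
Lemma mean_continuous (F : R -> Om -> R) (g : Om -> R) (t : R) :
  (forall s, measurable_fun setT (F s)) -> intg g ->
  (forall s, {ae P, forall w, `|F s w| <= g w}) ->
  {ae P, forall w, {for t, continuous (F^~ w)}} ->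
  {for t, continuous (fun s => mean (F s))}.
Proof.
move=> mF gi Fg cF; apply/(@cvg_nbhsP _ R^o) => s st.
have Fi r : intg (F r) by exact: integrable_ae_bound (Fg r) gi.
apply: fine_cvg; rewrite fineK; last exact: integrable_fin_num (Fi t).
have [] := @dominated_convergence _ _ _ P setT measurableT
  (fun n w => (F (s n) w)%:E) (fun w => (F t w)%:E) (fun w => (g w)%:E).
- by move=> n; exact/measurable_EFinP.
- exact/measurable_EFinP.
- apply: filterS cF => w cF _; apply: cvg_EFin; first exact: nearW.
  by move/(@cvg_nbhsP _ R^o) : cF => /(_ s st).
- exact: gi.
- have : {ae P, forall w n, `|F (s n) w| <= g w} by apply/ae_foralln => n; exact: Fg.
  by apply: filterS => w H n _; rewrite lee_fin.
- by [].
Qed.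

End integrable_functions.

(** * The state price density *)

Section state_price_density.
Variables (R : realType) (d : measure_display) (Om : measurableType d).
Variables (P : probability Om R) (m : nat) (M : market R Om m).
Hypothesis hM : complete_market P M.

Lemma pricing_dominated : charge_of_finite_measure (pricing M) `<< P.
Proof. by case: (pricing_lmm hM). Qed.

Lemma bank_measurable t : 0 <= t <= horizon M -> measurable_fun setT (bank M t).
Proof.
move=> tT _ B mB; rewrite setTI.
have [_ mono meas] := filt_filtration hM.
case/andP: (tT) => t0 tle.
by apply/meas/(mono t) => //; exact: (bank_adapted hM).
Qed.

Lemma state_price_measurable : measurable_fun setT (state_price P M).
Proof.
have T0 := ltW (horizon_gt0 hM).
apply: measurable_funM.
  apply: measurable_funM; first by apply: bank_measurable; rewrite lexx.
  have mT : measurable_fun setT (bank M (horizon M)).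
    by apply: bank_measurable; rewrite lexx T0.
  have -> : (fun w => (bank M (horizon M) w)^-1) =
      (fun w => expR (- ln (bank M (horizon M) w))).
    apply/funext => w; rewrite expRN lnK// posrE.
    by apply: (bank_gt0 hM); rewrite lexx T0.
  apply: (measurableT_comp (@measurable_expR R)).
  apply: measurableT_comp => //.
  exact: (measurableT_comp (@measurable_ln R)).
apply: measurableT_comp => //.
have := Radon_Nikodym_integrable pricing_dominated.
by apply: measurable_int.
Qed.

(** The pricing measure gives no mass to the set where its density is not
    positive, and dominates the physical measure. *)
Lemma state_price_gt0 : {ae P, forall w, 0 < state_price P M w}.
Proof.
have T0 := ltW (horizon_gt0 hM).
pose rn := Radon_Nikodym (charge_of_finite_measure (pricing M)) P.
have rn_int : P.-integrable setT rn := Radon_Nikodym_integrable pricing_dominated.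
have mrn : measurable_fun setT rn by apply: measurable_int rn_int.
pose N := [set w | (rn w <= 0)%E].
have mN : measurable N.
  by rewrite -[N]setTI; exact: emeasurable_fun_infty_c.
have QN : pricing M N = 0%E.
  have QNE : pricing M N = (\int[P]_(w in N) rn w)%E.
    exact: (Radon_Nikodym_integral pricing_dominated).
  apply/eqP; rewrite eq_le measure_ge0 andbT QNE.
  rewrite -[leRHS](integral0 P N); apply: le_integral => //.
  - exact: integrableS rn_int.
  - exact: integrable0.
  - by move=> w /set_mem.
have [_ PQ _] := pricing_lmm hM.
exists N; split => //; first by move/null_content_dominatesP : PQ; apply.
move=> w /=; rewrite /N/= => nw; rewrite leNgt; apply/negP => rn0; apply: nw.
rewrite /state_price mulr_gt0//.
  by rewrite divr_gt0// (bank_gt0 hM)// lexx T0.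
apply: fine_gt0; rewrite rn0/= ltey_eq.
by rewrite (Radon_Nikodym_fin_num _ pricing_dominated).
Qed.

End state_price_density.

(** * Choice of the cutoff and of the multiplier *)

Section cutoff_wealth.
Variables (R : realType) (d : measure_display) (Om : measurableType d).
Variables (P : probability Om R) (xi : Om -> R).
Hypotheses (mxi : measurable_fun setT xi) (xi_gt0 : {ae P, forall w, 0 < xi w}).
Hypothesis (xi_int : P.-integrable setT (EFin \o xi)).
Hypothesis xi_atomless : atomless_rv P xi.
Local Notation mean f := (\int[P]_w (f : Om -> R) w)%R.
Local Notation intg f := (P.-integrable setT (EFin \o (f : Om -> R))).
Implicit Types a b c t x : R.

Lemma xi_neq c : {ae P, forall w, xi w != c}.
Proof. exact: ae_neq. Qed.

(** The distribution function is continuous, as [xi] has no atoms, and tends to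
    one. *)
Lemma exists_quantile b (q : R) : 0 < b -> (P [set w | (xi w < b)%R] < q%:E)%E ->
  q < 1 -> exists2 c, b < c & P [set w | (xi w < c)%R] = q%:E.
Proof.
move=> b0 bq q1.
pose F s := mean (\1_[set w | xi w < s]).
have FE s : P [set w | xi w < s] = (F s)%:E.
  rewrite /F mean_indic; first by rewrite fineK// fin_num_measure//; exact: measurable_lt_set.
  exact: measurable_lt_set.
have cF : continuous F.
  move=> s; apply: (@mean_continuous _ _ _ _ _ (cst 1)).
  - by move=> r; apply: measurable_indic; exact: measurable_lt_set.
  - exact: finite_measure_integrable_cst.
  - move=> r; apply: aeW => w; rewrite indic_lt_set.
    by case: (_ < _); rewrite ?normr1 ?normr0/=.
  apply: filterS (xi_neq s) => w; rewrite neq_lt => /orP[ws|sw].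
    apply: (@near_cst_continuous _ _ (1 : R)); near=> r.
    rewrite indic_lt_set; have -> // : xi w < r by near: r; exact: lt_nbhsr.
  apply: (@near_cst_continuous _ _ (0 : R)); near=> r.
  rewrite indic_lt_set ltNge; have -> // : r <= xi w by apply: ltW; near: r; exact: lt_nbhsl.
(* by Markov's inequality, [P (xi >= T) <= E xi / T <= 1 - q] *)
pose T := Num.max b (mean xi / (1 - q)).
have T0 : 0 < T by rewrite lt_max b0.
have FT : q <= F T.
  apply: (@le_trans _ _ (1 - T^-1 * mean xi)).
    have : mean xi <= T * (1 - q).
      by rewrite -ler_pdivrMr ?subr_gt0// le_max lexx orbT.
    by rewrite -ler_pdivrMl//; lra.
  have -> : 1 - T^-1 * mean xi = mean (fun w => 1 - T^-1 * xi w).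
    rewrite RintegralB//.
    - by rewrite RintegralZl// mean_cst.
    - exact: (finite_measure_integrable_cst P 1).
    - exact: integrableZr.
  apply: ae_le_mean.
  - apply: integrableBr; first exact: (finite_measure_integrable_cst P 1).
    exact: integrableZr.
  - by apply: integrable_indic; exact: measurable_lt_set.
  apply: filterS xi_gt0 => w w0; rewrite indic_lt_set; case: ltP => wT /=.
    by rewrite lerBlDr lerDl mulr_ge0// ?invr_ge0 ltW.
  by rewrite subr_le0 ler_pdivlMl// mulr1.
rewrite FE lte_fin in bq.
have [| | |c] := @IVT R F b T q.
- by rewrite le_max lexx.
- exact: continuous_subspaceT.
- by rewrite ge_min (ltW bq) le_max FT orbT.
rewrite in_itv/= => /andP[bc _] Fc; exists c; last by rewrite FE Fc.
rewrite lt_neqAle bc andbT; apply/eqP => bc'.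
by move: bq; rewrite bc' Fc ltxx.
Unshelve. all: by end_near. Qed.

Section multiplier.
Variables (U : R -> R) (D Dh lamB L : R).
Hypotheses (hU : utility U) (D0 : 0 < D) (hDh : tangency_point U D Dh).
Hypotheses (L0 : 0 < L) (LDh : L <= Dh) (lamB0 : 0 < lamB).
Local Notation u := (surplus_utility U D).
Local Notation k := (derive1 U (Dh - D)).
Local Notation XB := (benchmark U D Dh lamB xi).

Lemma scaled_demand_measurable t :
  measurable_fun setT (scaled_demand U D L t).
Proof.
apply: (measurability (@RGenCInfty.G R)) => [|/= _ [_] [r] -> <-].
  exact: RGenCInfty.measurableE.
rewrite setTI; apply: is_interval_measurable => s v/=.
rewrite !in_itv/= !andbT => rs rv w /andP[sw wv]; rewrite in_itv/= andbT.
have [rL|Lr] := leP r L; first exact: le_trans rL (scaled_demand_ge _ _ _ _ _).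
have s0 : 0 < s.
  rewrite ltNge; apply/negP => s0; move: rs; rewrite leNgt => /negP; apply.
  rewrite /scaled_demand; case: ifP => // t0.
  have /negbTE st0 : ~~ (0 < s / t) by rewrite -leNgt pmulr_lle0 ?invr_gt0.
  by rewrite /floor_demand st0.
by apply: (le_trans rv); apply: scaled_demand_le => //; exact: lt_le_trans sw.
Qed.

Lemma cutoff_demand_measurable t c :
  measurable_fun setT (fun w => cutoff_demand U D L t c (xi w)).
Proof.
apply: measurable_fun_ifT => //.
  exact: measurable_fun_ltr.
exact: (measurableT_comp (scaled_demand_measurable t)).
Qed.

Lemma benchmark_ge0 w : 0 < xi w -> 0 <= XB w.
Proof.
move=> w0; rewrite /benchmark; case: ifP => // _.
have [I0 _] := inv_marginalP hU (mulr_gt0 lamB0 w0).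
by rewrite addr_ge0// ltW.
Qed.

Lemma benchmark_slope w : (xi w < k / lamB) = (lamB * xi w < k).
Proof. by rewrite ltr_pdivlMr// mulrC. Qed.

(** The budget is continuous in the weight [t] on utility.  It is at most
    [x0] for [t = 0], where the wealth is just the guarantee [L] below the
    cutoff, and at least [x0] for the benchmark weight. *)
Lemma exists_multiplier c x0 : k / lamB <= c -> measurable_fun setT XB ->
  intg (fun w => xi w * XB w) -> mean (fun w => xi w * XB w) = x0 ->
  L * mean (fun w => \1_[set w | xi w < c] w * xi w) <= x0 ->
  exists t, [/\ 0 <= t, t * k <= c,
    intg (fun w => xi w * cutoff_demand U D L t c (xi w)) &
    mean (fun w => xi w * cutoff_demand U D L t c (xi w)) = x0].
Proof.
move=> kc mXB XBi XBx0 Lx0.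
have k0 := tangency_slope_gt0 hU hDh.
pose b := lamB^-1; have b0 : 0 < b by rewrite invr_gt0.
(* demand at the weights in question is at most the benchmark where the latter
   is positive, and at most the demand at the price [k] elsewhere *)
pose K := floor_demand U D L k.
have K0 : 0 <= K := le_trans (ltW L0) (floor_demand_ge _ _ _ _).
pose F s w := xi w * cutoff_demand U D L (Num.min s b) c (xi w).
pose g w := xi w * XB w + K * xi w.
have gi : intg g by apply: integrableDr => //; exact: integrableZr.
have mF s : measurable_fun setT (F s).
  by apply: measurable_funM => //; exact: cutoff_demand_measurable.
have Fg s : {ae P, forall w, `|F s w| <= g w}.
  apply: filterS xi_gt0 => w w0.
  have X0 := cutoff_demand_ge0 U D L0 (Num.min s b) c (xi w).
  rewrite ger0_norm ?mulr_ge0 ?(ltW w0)// /F /g (mulrC K) -mulrDr ler_pM2l//.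
  have XB0 := benchmark_ge0 w0.
  rewrite /cutoff_demand; case: ifP => _; last by rewrite addr_ge0.
  have sb : Num.min s b <= b by rewrite ge_min lexx orbT.
  apply: (le_trans (scaled_demand_le_floor D L hU b0 sb w0)).
  rewrite /b invrK mulrC; have [kw|wk] := leP k (lamB * xi w).
    apply: (@le_trans _ _ K); last by rewrite lerDr.
    by apply: floor_demand_le.
  rewrite (floor_demand_benchmark hU D0 hDh (ltW L0) LDh)// ?mulr_gt0//.
  by rewrite /benchmark benchmark_slope wk lerDl.
have cF : continuous (fun s => mean (F s)).
  move=> s; apply: (mean_continuous mF gi Fg).
  have [z0 Hz0] := scaled_demand_continuous D L hU.
  apply: filterS2 xi_gt0 (xi_neq (Num.min s b * z0)) => w w0 ws.
  apply: cvgM; first exact: cvg_cst.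
  rewrite /cutoff_demand; case: ifP => _; last exact: cvg_cst.
  apply: (@continuous_comp _ _ _ (fun s => Num.min s b)
    (fun t => scaled_demand U D L t (xi w))); last exact: Hz0.
  by apply: continuous_min; [exact: cvg_id|exact: cvg_cst].
have F0 : mean (F 0) <= x0.
  apply: le_trans Lx0; rewrite -RintegralZl//; last first.
    by apply: integrable_indic_mul => //; exact: measurable_lt_set.
  rewrite le_eqVlt; apply/orP; left; apply/eqP; apply: eq_Rintegral => w _.
  rewrite /F (min_l (ltW b0)) indic_lt_set /cutoff_demand /scaled_demand ltxx.
  by case: ifP => _ /=; ring.
have Fb : x0 <= mean (F b).
  rewrite -XBx0; apply: ae_le_mean => //.
    exact: integrable_ae_bound (Fg b) gi.
  apply: filterS xi_gt0 => w w0; rewrite /F ler_pM2l//.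
  rewrite {1}/benchmark; case: ifPn => wk; last exact: cutoff_demand_ge0.
  rewrite /cutoff_demand (lt_le_trans wk kc) minxx /scaled_demand b0.
  rewrite /b invrK (mulrC (xi w) lamB) (floor_demand_benchmark hU D0 hDh (ltW L0) LDh)//.
    exact: mulr_gt0.
  by rewrite -benchmark_slope.
have [| |s] := @IVT R (fun s => mean (F s)) 0 b x0 (ltW b0).
- exact: continuous_subspaceT.
- by rewrite ge_min F0 le_max Fb orbT.
rewrite in_itv/= => /andP[s0 sb] Fs.
have FE : F s = fun w => xi w * cutoff_demand U D L s c (xi w).
  by rewrite /F (min_l sb).
exists s; split => //.
- apply: le_trans kc; rewrite mulrC ler_wpM2l// ltW//.
- rewrite -FE; exact: integrable_ae_bound (Fg s) gi.
- by rewrite -FE.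
Qed.

End multiplier.
End cutoff_wealth.

(** * The case where the budget only pays for the guarantee *)

Section capped_lagrangian.
Variables (R : realType) (U : R -> R) (D Dh L : R).
Hypotheses (hU : utility U) (D0 : 0 < D) (hDh : tangency_point U D Dh).
Hypotheses (L0 : 0 < L) (LDh : L <= Dh).
Variable c : R.
Hypothesis c0 : 0 < c.
Implicit Types x y : R.
Local Notation u := (surplus_utility U D).

Lemma cutoff_demand0 x :
  cutoff_demand U D L 0 c x = if x < c then L else 0.
Proof. by rewrite /cutoff_demand /scaled_demand ltxx. Qed.

(** For wealths at most [L] the chord replaces utility by a linear function; the
    multiplier is chosen so that its slope changes sign at the cutoff. *)
Lemma capped_lagrangian_le x y : 0 < x -> 0 <= y -> y <= L ->
  c * L * u y - u L * (x * y) <=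
  c * L * u (cutoff_demand U D L 0 c x)
    - u L * (x * cutoff_demand U D L 0 c x).
Proof.
move=> x0 y0 yL; rewrite cutoff_demand0.
have uL := surplus_utility_ge0 D hU L.
have := surplus_chord hU D0 hDh y0 yL LDh.
have L0' := L0; have c0' := c0 => ch.
have cch : c * (u y * L) <= c * (u L * y) by rewrite ler_pM2l.
case: ltP => xc; last first.
  rewrite (surplus_utility_below hU (ltW D0)) !mulr0 subrr subr_le0.
  have : c * (u L * y) <= x * (u L * y) by rewrite ler_wpM2r// mulr_ge0.
  lra.
have : (c - x) * u L * y <= (c - x) * u L * L.
  by rewrite ler_wpM2l// mulr_ge0// subr_ge0 ltW.
lra.
Qed.

Lemma capped_lagrangian_lt x y : D < L -> 0 < x -> x != c -> 0 <= y -> y <= L ->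
  y != cutoff_demand U D L 0 c x ->
  c * L * u y - u L * (x * y) <
  c * L * u (cutoff_demand U D L 0 c x)
    - u L * (x * cutoff_demand U D L 0 c x).
Proof.
move=> DL x0 xc y0 yL; rewrite cutoff_demand0.
have uL := surplus_utility_gt0 hU DL.
have := surplus_chord hU D0 hDh y0 yL LDh.
have L0' := L0; have c0' := c0 => ch.
have cch : c * (u y * L) <= c * (u L * y) by rewrite ler_pM2l.
case: ltP => cx yX; last first.
  rewrite (surplus_utility_below hU (ltW D0)) !mulr0 subrr subr_lt0.
  have y_gt0 : 0 < y by rewrite lt_neqAle eq_sym yX.
  have c_x : c < x by rewrite lt_neqAle eq_sym xc.
  have : c * (u L * y) < x * (u L * y) by rewrite ltr_pM2r// mulr_gt0.
  lra.
have y_L : y < L by rewrite lt_neqAle yX.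
have : (c - x) * u L * y < (c - x) * u L * L.
  by rewrite ltr_pM2l// mulr_gt0// subr_gt0.
lra.
Qed.

End capped_lagrangian.

(** * Admissible wealths and the optimization problems *)

Section market.
Variables (R : realType) (d : measure_display) (Om : measurableType d).
Variables (P : probability Om R) (m : nat) (M : market R Om m).
Variables (U : R -> R) (D Dh x0 lamB : R).
Local Notation xi := (state_price P M).
Local Notation XB := (benchmark U D Dh lamB xi).
Local Notation opt := (optimal P M U D x0).
Local Notation admissible := (terminal_wealths P M x0).
Local Notation u := (surplus_utility U D).
Local Notation k := (derive1 U (Dh - D)).
Local Notation mean f := (\int[P]_w (f : Om -> R) w)%R.
Local Notation intg f := (P.-integrable setT (EFin \o (f : Om -> R))).
Hypotheses (hM : complete_market P M) (xi_atomless : atomless_rv P xi).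
Hypothesis (xi_lty : ('E_P[xi] < +oo)%E).
Hypotheses (D0 : 0 < D) (hU : utility U) (hDh : tangency_point U D Dh).
Hypotheses (lamB0 : 0 < lamB).
Hypothesis XBopt : opt setT XB.
Implicit Types (X Y : Om -> R) (L a c eps : R).

Let mxi : measurable_fun setT xi := state_price_measurable hM.
Let xi_gt0 := state_price_gt0 hM.

Let xi_int : intg xi.
Proof. by apply: integrable_ae_ge0 => //; apply: filterS xi_gt0 => w /ltW. Qed.

Lemma generic_state c c' :
  {ae P, forall w, [/\ 0 < xi w, xi w != c & xi w != c']}.
Proof.
by apply: filterS3 xi_gt0 (xi_neq mxi xi_atomless c) (xi_neq mxi xi_atomless c').
Qed.

Lemma admissible_measurable X : admissible X -> measurable_fun setT X.
Proof. by case. Qed.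

Lemma admissible_ge0 X w : admissible X -> 0 <= X w.
Proof. by case. Qed.

Lemma admissible_budget X : admissible X ->
  intg (fun w => xi w * X w) /\ mean (fun w => xi w * X w) = x0.
Proof.
move=> [mX _ X0 EX].
have Xi : intg (fun w => xi w * X w).
  apply: integrable_ae_ge0; first exact: measurable_funM.
    by apply: filterS xi_gt0 => w w0; rewrite mulr_ge0// ltW.
  by rewrite EX ltry.
by split => //; move: EX; rewrite expectation_mean// => -[].
Qed.

Lemma surplus_measurable X : measurable_fun setT X ->
  measurable_fun setT (fun w => u (X w)).
Proof.
move=> mX; apply: measurableT_comp mX.
by apply: nondecreasing_measurable => // x y; exact: surplus_utility_le.
Qed.

(** The benchmark maximizes over all admissible wealths, and its expected utility
    is finite. *)
Lemma admissible_utility_integrable X : admissible X ->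
  intg (fun w => u (X w)).
Proof.
move=> aX; have mX := admissible_measurable aX.
apply: integrable_ae_ge0; first exact: surplus_measurable.
  by apply: aeW => w; exact: surplus_utility_ge0.
have [_ XBoo XBmax] := XBopt.
apply: le_lt_trans XBoo; apply: XBmax; split => //.
by case: aX => _ _ _ ->.
Qed.

Lemma exp_utility_mean X : admissible X ->
  exp_utility P U D X = (mean (fun w => u (X w)))%:E.
Proof. by move=> aX; exact/expectation_mean/admissible_utility_integrable. Qed.

Lemma optimalP (C : set (Om -> R)) X : opt C X <->
  [/\ admissible X, C X & forall Y, admissible Y -> C Y ->
    mean (fun w => u (Y w)) <= mean (fun w => u (X w))].
Proof.
split=> [[[aX _ CX] _ Xmax]|[aX CX Xmax]].
  split => // Y aY CY; rewrite -lee_fin -!exp_utility_mean//.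
  by apply: Xmax; split => //; case: aY => _ _ _ ->.
split.
- by split => //; case: aX => _ _ _ ->.
- by rewrite exp_utility_mean// ltry.
- by move=> Y [aY _ CY]; rewrite !exp_utility_mean// lee_fin Xmax.
Qed.

Lemma replicable_admissible X : measurable_fun setT X -> (forall w, 0 <= X w) ->
  intg (fun w => xi w * X w) -> mean (fun w => xi w * X w) = x0 ->
  admissible X.
Proof.
move=> mX X0 Xi EX; have EX' : 'E_P[(fun w => xi w * X w)%R]%E = x0%:E.
  by rewrite expectation_mean// EX.
by split => //; apply: (complete hM) => //; rewrite EX' ltry.
Qed.

Lemma shortfall_measurable L X : measurable_fun setT X ->
  measurable_fun setT (fun w => Num.max (L - X w) 0).
Proof. by move=> mX; apply: measurable_maxr => //; exact: measurable_funB. Qed.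

Lemma shortfall_bound L x : 0 <= L -> 0 <= x -> 0 <= Num.max (L - x) 0 <= L.
Proof. by move=> L0 x0'; rewrite le_max lexx orbT ge_max L0 lerBlDr lerDl x0'. Qed.

Lemma shortfall_integrable L X : 0 <= L -> admissible X ->
  intg (fun w => Num.max (L - X w) 0).
Proof.
move=> L0 aX; have mX := admissible_measurable aX.
apply: (@integrable_ae_bound _ _ _ _ _ (cst L)).
- exact: shortfall_measurable.
- apply: aeW => w; have /andP[s0 sL] := shortfall_bound L0 (admissible_ge0 w aX).
  by rewrite ger0_norm.
- exact: finite_measure_integrable_cst.
Qed.

Lemma weighted_shortfall_integrable L X : 0 <= L -> admissible X ->
  intg (fun w => xi w * Num.max (L - X w) 0).
Proof.
move=> L0 aX; have mX := admissible_measurable aX.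
apply: (@integrable_ae_bound _ _ _ _ _ (fun w => L * xi w)).
- by apply: measurable_funM => //; exact: shortfall_measurable.
- apply: filterS xi_gt0 => w w0.
  have /andP[s0 sL] := shortfall_bound L0 (admissible_ge0 w aX).
  rewrite ger0_norm; last by rewrite mulr_ge0// ltW.
  by rewrite (mulrC L) ler_pM2l.
- exact: integrableZr.
Qed.

Lemma ESP_mean L eps X : 0 <= L -> admissible X ->
  ESP P L eps X <-> mean (fun w => Num.max (L - X w) 0) <= eps.
Proof.
move=> L0 aX; have si := shortfall_integrable L0 aX.
by rewrite /ESP/= expectation_mean// lee_fin.
Qed.

Lemma ESQ_mean L eps X : 0 <= L -> admissible X ->
  ESQ P xi L eps X <-> mean (fun w => xi w * Num.max (L - X w) 0) <= eps.
Proof.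
move=> L0 aX; have si := weighted_shortfall_integrable L0 aX.
by rewrite /ESQ/= expectation_mean// lee_fin.
Qed.

(** The shortfall is at most [L], and vanishes outside an event of probability at
    most [a]. *)
Lemma VaR_ESP L a X : 0 <= L -> admissible X -> VaR P L a X ->
  ESP P L (L * a) X.
Proof.
move=> L0 aX; have mX := admissible_measurable aX.
have mA := measurable_ge_set L mX.
rewrite /VaR/= => H; apply/ESP_mean => //.
have Pfin : P [set w | L <= X w] = (mean (\1_[set w | L <= X w]))%:E.
  by rewrite mean_indic// fineK// fin_num_measure.
rewrite Pfin lee_fin in H.
have ii : intg (\1_[set w | L <= X w]) by exact: integrable_indic.
have i1 : intg (fun w => 1 - \1_[set w | L <= X w] w).
  by apply: integrableBr => //; exact: (finite_measure_integrable_cst P 1).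
apply: (@le_trans _ _ (mean (fun w => L * (1 - \1_[set w | L <= X w] w)))).
  apply: ae_le_mean.
  - exact: shortfall_integrable.
  - exact: integrableZr.
  apply: aeW => w; have X0 := admissible_ge0 w aX.
  rewrite indic_ge_set; case: (leP L (X w)) => LX /=.
    by rewrite subrr mulr0 max_r// subr_le0.
  by rewrite subr0 mulr1; case/andP: (shortfall_bound L0 X0).
rewrite RintegralZl// ler_wpM2l// RintegralB//.
- by rewrite mean_cst; lra.
- exact: (finite_measure_integrable_cst P 1).
Qed.

(** Integrating a pointwise Lagrangian bound.  The budgets agree and the
    penalty of [Y] is at most that of [X], so that only the utilities remain;
    if these agree too, then the pointwise bound is an equality. *)
Lemma lagrangian_mean (al be p : R) (hX hY : Om -> R) X Y :
  admissible X -> admissible Y -> 0 <= p -> intg hX -> intg hY ->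
  mean hY <= mean hX ->
  let G Z hZ w := al * u (Z w) - be * (xi w * Z w) - p * hZ w in
  {ae P, forall w, G Y hY w <= G X hX w} ->
  al * mean (fun w => u (Y w)) <= al * mean (fun w => u (X w)) /\
  (al * mean (fun w => u (X w)) <= al * mean (fun w => u (Y w)) ->
   {ae P, forall w, G Y hY w = G X hX w}).
Proof.
move=> aX aY p0 iX iY hYX G GYX.
have Gi Z hZ : admissible Z -> intg hZ -> intg (G Z hZ) /\
    mean (G Z hZ) = al * mean (fun w => u (Z w)) - be * x0 - p * mean hZ.
  move=> aZ hZi; have [bZ bx0] := admissible_budget aZ.
  have uZ := admissible_utility_integrable aZ.
  have i1 : intg (fun w => al * u (Z w)) by exact: integrableZr.
  have i2 : intg (fun w => be * (xi w * Z w)) by exact: integrableZr.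
  have i3 : intg (fun w => p * hZ w) by exact: integrableZr.
  have i12 : intg (fun w => al * u (Z w) - be * (xi w * Z w)).
    exact: integrableBr.
  split; first exact: integrableBr.
  by rewrite /G RintegralB// RintegralB// !RintegralZl// bx0.
have [GXi GXE] := Gi X hX aX iX; have [GYi GYE] := Gi Y hY aY iY.
have phYX : p * mean hY <= p * mean hX by rewrite ler_wpM2l.
split.
  have := ae_le_mean GYi GXi GYX; rewrite GXE GYE; lra.
move=> uXY; apply: ae_eq_of_mean_le => //; rewrite GXE GYE; lra.
Qed.

(** * Solutions with a cutoff *)

(** The insured and defaulting states are required only almost surely, so that
    the property passes to every almost surely equal admissible wealth. *)
Record cutoff_solution L a c X : Prop := {
  cutoff_admissible : admissible X ;
  cutoff_quantile : P [set w | (xi w < c)%R] = (1 - a)%:E ;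
  cutoff_insured : {ae P, forall w, xi w < c -> L <= X w} ;
  cutoff_default : {ae P, forall w, c <= xi w -> X w = 0} ;
  cutoff_ESP : forall Y, admissible Y -> ESP P L (L * a) Y ->
    mean (fun w => u (Y w)) <= mean (fun w => u (X w)) /\
    (mean (fun w => u (X w)) <= mean (fun w => u (Y w)) ->
      {ae P, forall w, Y w = X w}) ;
  cutoff_ESQ : forall Y, admissible Y ->
    ESQ P xi L (L * mean (fun w => \1_[set w | c <= xi w] w * xi w)) Y ->
    mean (fun w => u (Y w)) <= mean (fun w => u (X w)) /\
    (D < L -> mean (fun w => u (X w)) <= mean (fun w => u (Y w)) ->
      {ae P, forall w, Y w = X w}) }.

Lemma integrable_xi_ge c : intg (\1_[set w | c <= xi w]).
Proof. by apply: integrable_indic; exact: measurable_ge_set. Qed.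

Lemma mean_xi_ge c a : P [set w | (xi w < c)%R] = (1 - a)%:E ->
  mean (\1_[set w | c <= xi w]) = a.
Proof.
move=> Pc; rewrite mean_indic ?ge_setE; last exact/measurableC/measurable_lt_set.
rewrite probability_setC ?Pc; last exact: measurable_lt_set.
by rewrite -EFinB/= opprB addrC subrK.
Qed.

(** Among the wealths with a given expected shortfall, insuring the states with
    the lowest prices is the cheapest; this is the Neyman-Pearson argument with
    multiplier [c]. *)
Lemma insured_budget L a c Y : 0 < L -> 0 < c ->
  P [set w | (xi w < c)%R] = (1 - a)%:E -> admissible Y ->
  ESP P L (L * a) Y ->
  L * mean (fun w => \1_[set w | xi w < c] w * xi w) <= x0.
Proof.
move=> L0 c0 Pc aY /(ESP_mean _ (ltW L0) aY) sY.
have [iY <-] := admissible_budget aY.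
have isY := shortfall_integrable (ltW L0) aY.
have ic : intg (fun w => \1_[set w | xi w < c] w * xi w).
  by apply: integrable_indic_mul => //; exact: measurable_lt_set.
rewrite -RintegralZl//.
have : mean (fun w => L * (\1_[set w | xi w < c] w * xi w)) <=
    mean (fun w => xi w * Y w + c * Num.max (L - Y w) 0
                   - c * L * \1_[set w | c <= xi w] w).
  apply: ae_le_mean.
  - exact: integrableZr.
  - apply: integrableBr; last by apply: integrableZr; exact: integrable_xi_ge.
    by apply: integrableDr => //; exact: integrableZr.
  apply: filterS xi_gt0 => w w0; rewrite indic_lt_set indic_ge_set.
  have Y0 := admissible_ge0 w aY.
  have h1 : L - Y w <= Num.max (L - Y w) 0 by rewrite le_max lexx.
  have h0 : 0 <= Num.max (L - Y w) 0 by rewrite le_max lexx orbT.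
  case: ltP => xc /=.
    rewrite mul1r mulr0 subr0.
    have : xi w * (L - Y w) <= c * Num.max (L - Y w) 0.
      apply: (@le_trans _ _ (xi w * Num.max (L - Y w) 0)).
        by rewrite ler_pM2l.
      by rewrite ler_wpM2r// ltW.
    lra.
  rewrite mul0r mulr0 mulr1.
  have : c * Y w <= xi w * Y w by rewrite ler_wpM2r.
  have : c * (L - Y w) <= c * Num.max (L - Y w) 0 by rewrite ler_pM2l.
  lra.
rewrite RintegralB//; last 2 first.
- by apply: integrableDr => //; exact: integrableZr.
- by apply: integrableZr; exact: integrable_xi_ge.
rewrite RintegralD//; last exact: integrableZr.
rewrite !RintegralZl//; last exact: integrable_xi_ge.
rewrite (mean_xi_ge Pc) => H; apply: (le_trans H).
have : c * mean (fun w => Num.max (L - Y w) 0) <= c * (L * a) by rewrite ler_pM2l.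
lra.
Qed.

(** Any wealth that meets the shortfall bound shows that the guarantee [L] below
    the cutoff is affordable, which is what the choice of the multiplier needs. *)
Lemma exists_cutoff_solution L a c : 0 < L -> L <= Dh -> k / lamB <= c ->
  P [set w | (xi w < c)%R] = (1 - a)%:E ->
  (exists2 Y, admissible Y & ESP P L (L * a) Y) ->
  exists X, cutoff_solution L a c X.
Proof.
move=> L0 LDh kc Pc [Y0 aY0 sY0].
have k0 := tangency_slope_gt0 hU hDh.
have c0 : 0 < c by apply: lt_le_trans kc; rewrite divr_gt0.
have aXB : admissible XB by case: XBopt => -[].
have [iXB mXBx0] := admissible_budget aXB.
have [t [t0 tkc Xi Xx0]] := exists_multiplier mxi xi_gt0 xi_int xi_atomless hU
  D0 hDh L0 LDh lamB0 kc (admissible_measurable aXB) iXB mXBx0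
  (insured_budget L0 c0 Pc aY0 sY0).
pose X w := cutoff_demand U D L t c (xi w).
have aX : admissible X.
  apply: replicable_admissible => //.
  - exact: cutoff_demand_measurable.
  - by move=> w; exact: cutoff_demand_ge0.
have sX w : Num.max (L - X w) 0 = L * \1_[set w | c <= xi w] w.
  rewrite shortfall_cutoff// indic_ge_set.
  by case: ltP => _ /=; rewrite ?mulr0 ?mulr1.
have msX : mean (fun w => Num.max (L - X w) 0) = L * a.
  under eq_Rintegral do rewrite sX.
  by rewrite RintegralZl ?(mean_xi_ge Pc)//; exact: integrable_xi_ge.
have ige : intg (fun w => \1_[set w | c <= xi w] w * xi w).
  by apply: integrable_indic_mul => //; exact: measurable_ge_set.
have mwX : mean (fun w => xi w * Num.max (L - X w) 0) =
    L * mean (fun w => \1_[set w | c <= xi w] w * xi w).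
  by rewrite -RintegralZl//; apply: eq_Rintegral => w _; rewrite sX; ring.
exists X; split => //.
- apply: aeW => w xc; rewrite /X /cutoff_demand xc; exact: scaled_demand_ge.
- by apply: aeW => w; rewrite /X /cutoff_demand ltNge => ->.
- move=> Y aY /(ESP_mean _ (ltW L0) aY) sY.
  have [z0 Hz0] := shortfall_lagrangian_lt hU D0 hDh L0 LDh t0 c0.
  have mu0 := cutoff_multiplier_ge0 hU D0 hDh L0 t0 tkc.
  have good := generic_state c (t * z0).
  have [] := @lagrangian_mean t 1 _ _ _ _ _ aX aY mu0
    (shortfall_integrable (ltW L0) aX) (shortfall_integrable (ltW L0) aY).
  + by rewrite msX.
  + apply: filterS good => w [w0 wc wz]; rewrite !mul1r.
    have [->//|YX] := eqVneq (Y w) (X w).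
    by apply/ltW/Hz0 => //; exact: admissible_ge0.
  move=> le_u eq_u.
  have YX : t * mean (fun w => u (X w)) <= t * mean (fun w => u (Y w)) ->
      {ae P, forall w, Y w = X w}.
    move=> /eq_u; apply: filterS2 good => w [w0 wc wz]; rewrite !mul1r => GE.
    apply/eqP/negPn/negP => YX.
    have := Hz0 _ _ w0 wc wz (admissible_ge0 w aY) YX.
    by rewrite -/(X w) GE ltxx.
  (* for [t = 0] the Lagrangian shows that [X] is the only feasible wealth *)
  move: t0; rewrite le_eqVlt => /predU1P[t0|t0].
    have {}YX : {ae P, forall w, Y w = X w} by apply: YX; rewrite -t0 !mul0r.
    split => //; rewrite le_eqVlt; apply/orP; left; apply/eqP.
    apply: mean_ae_eq; last by apply: filterS YX => w ->.
    + exact/surplus_measurable/admissible_measurable.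
    + exact/surplus_measurable/admissible_measurable.
  by split => [|H]; [rewrite -(ler_pM2l t0)|apply: YX; rewrite ler_pM2l].
- move=> Y aY /(ESQ_mean _ (ltW L0) aY) sY.
  have wiX := weighted_shortfall_integrable (ltW L0) aX.
  have wiY := weighted_shortfall_integrable (ltW L0) aY.
  move: (t0); rewrite le_eqVlt => /predU1P[t_0|t_gt0]; last first.
    have mu0 := cutoff_multiplier_ge0 hU D0 hDh L0 t0 tkc.
    have [] := @lagrangian_mean t 1 _ _ _ _ _ aX aY (divr_ge0 mu0 (ltW c0)) wiX wiY.
    + by rewrite mwX.
    + apply: filterS xi_gt0 => w w0; rewrite !mul1r !(mulrA _ (xi w)).
      apply: (weighted_shortfall_lagrangian_le hU D0 hDh L0 LDh t0 c0 w0).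
      exact: admissible_ge0.
    move=> le_u eq_u; split; first by rewrite -(ler_pM2l t_gt0).
    move=> DL uXY.
    have [z0 Hz0] := weighted_shortfall_lagrangian_lt hU D0 hDh L0 LDh t0 c0 t_gt0 DL.
    rewrite ler_pM2l// in eq_u; have := eq_u uXY.
    apply: filterS2 (generic_state c (t * z0)) => w [w0 wc wz].
    rewrite !mul1r !(mulrA _ (xi w)) => GE.
    apply/eqP/negPn/negP => YX.
    have := Hz0 _ _ w0 wc wz (admissible_ge0 w aY) YX.
    by rewrite -/(X w) GE ltxx.
  have X_0 w : X w = cutoff_demand U D L 0 c (xi w) by rewrite /X -t_0.
  (* for [t = 0], [X] never exceeds [L] and spends the whole budget, so the two
     constraints on [Y] leave nothing to spend above [L] *)
  have YL : {ae P, forall w, Y w <= L}.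
    have [biY bY] := admissible_budget aY; have [biX bX] := admissible_budget aX.
    have iLxi : intg (fun w => L * xi w) by exact: integrableZr.
    pose e Z w := xi w * Num.max (L - Z w) 0 + xi w * Z w - L * xi w.
    have ei Z : intg (fun w => xi w * Num.max (L - Z w) 0) ->
        intg (fun w => xi w * Z w) -> intg (e Z).
      by move=> *; apply: integrableBr => //; exact: integrableDr.
    have eE Z : intg (fun w => xi w * Num.max (L - Z w) 0) ->
        intg (fun w => xi w * Z w) -> mean (e Z) =
        mean (fun w => xi w * Num.max (L - Z w) 0)
        + mean (fun w => xi w * Z w) - mean (fun w => L * xi w).
      by move=> i1 i2; rewrite RintegralB ?RintegralD//; exact: integrableDr.
    have eX : mean (e X) = 0.
      rewrite -[RHS](mean_cst P); apply: eq_Rintegral => w _.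
      rewrite /e X_0 cutoff_demand0; case: ltP => _.
        by rewrite subrr maxxx; ring.
      by rewrite subr0 max_l ?(ltW L0)//; ring.
    have : {ae P, forall w, cst 0 w = e Y w}.
      apply: ae_eq_of_mean_le.
      - exact: finite_measure_integrable_cst.
      - exact: ei.
      - apply: filterS xi_gt0 => w w0 /=; rewrite /e.
        have -> : xi w * Num.max (L - Y w) 0 + xi w * Y w - L * xi w =
          xi w * (Num.max (L - Y w) 0 - (L - Y w)) by ring.
        by rewrite mulr_ge0 ?(ltW w0)// subr_ge0 le_max lexx.
      - rewrite [leRHS]mean_cst -eX !eE// bX bY lerD2r lerD2r mwX.
        exact: sY.
    apply: filterS2 xi_gt0 => w w0 /= e0; rewrite leNgt; apply/negP => LY.
    have : 0 < e Y w.
      rewrite /e max_r ?subr_le0 ?(ltW LY)// mulr0 add0r mulrC -mulrBl.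
      by rewrite mulr_gt0// subr_gt0.
    by rewrite -e0 ltxx.
  have cL : 0 < c * L by rewrite mulr_gt0.
  have i0 : intg (cst 0 : Om -> R) by exact: finite_measure_integrable_cst.
  have [] := @lagrangian_mean (c * L) (u L) 0 _ _ _ _ aX aY (lexx 0) i0 i0 (lexx _).
    apply: filterS2 xi_gt0 YL => w w0 YL; rewrite !mul0r !subr0 X_0.
    apply: (capped_lagrangian_le hU D0 hDh L0 LDh c0 w0 _ YL).
    exact: admissible_ge0.
  move=> le_u eq_u; split; first by rewrite -(ler_pM2l cL).
  move=> DL uXY; rewrite ler_pM2l// in eq_u; have := eq_u uXY.
  apply: filterS3 (generic_state c 0) YL => w [w0 wc _] YwL.
  rewrite !mul0r !subr0 X_0 => GE.
  apply/eqP/negPn/negP => YX.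
  have := capped_lagrangian_lt hU D0 hDh L0 LDh c0 DL w0 wc (admissible_ge0 w aY) YwL YX.
  by rewrite GE ltxx.
Qed.

Lemma cutoff_shortfall L a c X : 0 < L -> cutoff_solution L a c X ->
  {ae P, forall w, Num.max (L - X w) 0 = L * \1_[set w | c <= xi w] w}.
Proof.
move=> L0 cX; apply: filterS2 (cutoff_insured cX) (cutoff_default cX) => w.
rewrite indic_ge_set; case: ltP => xc /= LX X0.
  by rewrite mulr0 max_r// subr_le0 LX.
by rewrite X0// mulr1 subr0 max_l// ltW.
Qed.

Lemma cutoff_mean_shortfall L a c X : 0 < L -> cutoff_solution L a c X ->
  mean (fun w => Num.max (L - X w) 0) = L * a.
Proof.
move=> L0 cX; have mX := admissible_measurable (cutoff_admissible cX).
rewrite (mean_ae_eq _ _ (cutoff_shortfall L0 cX)).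
- by rewrite RintegralZl ?(mean_xi_ge (cutoff_quantile cX))//; exact: integrable_xi_ge.
- exact: shortfall_measurable.
- by apply: measurable_funM => //; apply: measurable_indic; exact: measurable_ge_set.
Qed.

Lemma cutoff_mean_weighted_shortfall L a c X : 0 < L ->
  cutoff_solution L a c X ->
  mean (fun w => xi w * Num.max (L - X w) 0) =
  L * mean (fun w => \1_[set w | c <= xi w] w * xi w).
Proof.
move=> L0 cX; have mX := admissible_measurable (cutoff_admissible cX).
have ige : intg (fun w => \1_[set w | c <= xi w] w * xi w).
  by apply: integrable_indic_mul => //; exact: measurable_ge_set.
rewrite -RintegralZl//; apply: mean_ae_eq.
- by apply: measurable_funM => //; exact: shortfall_measurable.
- by apply: measurable_funM => //; exact: integrable_measurable ige.
- by apply: filterS (cutoff_shortfall L0 cX) => w ->; ring.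
Qed.

Lemma cutoff_probability L a c X : 0 < L -> cutoff_solution L a c X ->
  P [set w | (L <= X w)%R] = (1 - a)%:E.
Proof.
move=> L0 cX; have mX := admissible_measurable (cutoff_admissible cX).
rewrite -(cutoff_quantile cX); apply: probability_ae_eq.
- exact: measurable_ge_set.
- exact: measurable_lt_set.
apply: filterS2 (cutoff_insured cX) (cutoff_default cX) => w ins def.
split=> [LX|]; last exact: ins.
by rewrite /= ltNge; apply/negP => /def X0; rewrite /= X0 leNgt L0 in LX.
Qed.

Lemma cutoff_optimal_ESP L a c X : 0 < L -> cutoff_solution L a c X ->
  opt (ESP P L (L * a)) X.
Proof.
move=> L0 cX; have aX := cutoff_admissible cX.
apply/optimalP; split => //.
- by apply/ESP_mean; rewrite ?(ltW L0)// (cutoff_mean_shortfall L0 cX).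
- by move=> Y aY /(cutoff_ESP cX aY)[].
Qed.

Lemma cutoff_optimal_ESQ L a c X : 0 < L -> cutoff_solution L a c X ->
  opt (ESQ P xi L (L * mean (fun w => \1_[set w | c <= xi w] w * xi w))) X.
Proof.
move=> L0 cX; have aX := cutoff_admissible cX.
apply/optimalP; split => //.
- by apply/ESQ_mean; rewrite ?(ltW L0)// (cutoff_mean_weighted_shortfall L0 cX).
- by move=> Y aY /(cutoff_ESQ cX aY)[].
Qed.

Lemma cutoff_optimal_VaR L a c X : 0 < L -> cutoff_solution L a c X ->
  opt (VaR P L a) X.
Proof.
move=> L0 cX; have aX := cutoff_admissible cX.
apply/optimalP; split => //.
- by rewrite /VaR/= (cutoff_probability L0 cX).
- by move=> Y aY /(VaR_ESP (ltW L0) aY)/(cutoff_ESP cX aY)[].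
Qed.

Lemma cutoff_unique_solution L a c X : 0 < L -> cutoff_solution L a c X ->
  [/\ forall Y, opt (VaR P L a) Y -> {ae P, forall w, Y w = X w},
      forall Y, opt (ESP P L (L * a)) Y -> {ae P, forall w, Y w = X w} &
      D < L -> forall Y, opt (ESQ P xi L
        (L * mean (fun w => \1_[set w | c <= xi w] w * xi w))) Y ->
        {ae P, forall w, Y w = X w}].
Proof.
move=> L0 cX; have aX := cutoff_admissible cX.
have /optimalP[_ VX _] := cutoff_optimal_VaR L0 cX.
have /optimalP[_ SX _] := cutoff_optimal_ESP L0 cX.
have /optimalP[_ QX _] := cutoff_optimal_ESQ L0 cX.
split.
- move=> Y /optimalP[aY VY Ymax]; apply: (cutoff_ESP cX aY _).2; last exact: Ymax.
  exact: VaR_ESP (ltW L0) _ _.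
- by move=> Y /optimalP[aY SY Ymax]; apply: (cutoff_ESP cX aY SY).2; exact: Ymax.
- move=> DL Y /optimalP[aY QY Ymax].
  by apply: (cutoff_ESQ cX aY QY).2 => //; exact: Ymax.
Qed.

Lemma cutoff_solution_ae_eq L a c X Y : cutoff_solution L a c X ->
  admissible Y -> {ae P, forall w, Y w = X w} -> cutoff_solution L a c Y.
Proof.
move=> cX aY YX.
have uYX : mean (fun w => u (Y w)) = mean (fun w => u (X w)).
  apply: mean_ae_eq; last by apply: filterS YX => w ->.
  - exact/surplus_measurable/admissible_measurable.
  - exact/surplus_measurable/admissible_measurable/(cutoff_admissible cX).
split => //.
- exact: cutoff_quantile cX.
- by apply: filterS2 YX (cutoff_insured cX) => w ->.
- by apply: filterS2 YX (cutoff_default cX) => w ->.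
- move=> Z aZ /(cutoff_ESP cX aZ); rewrite uYX => -[le_u eq_u]; split => //.
  by move=> /eq_u; apply: filterS2 YX => w -> ->.
- move=> Z aZ /(cutoff_ESQ cX aZ); rewrite uYX => -[le_u eq_u]; split => //.
  by move=> DL /(eq_u DL); apply: filterS2 YX => w -> ->.
Qed.

Let threshold_gt0 : 0 < k / lamB.
Proof. by rewrite divr_gt0// tangency_slope_gt0. Qed.

(** A given solution is feasible for the ESP problem, and the cutoff wealth is
    feasible for whichever problem it solves; the uniqueness in the ESP problem
    then identifies the two. *)
Lemma optimal_cutoff_solution L a X : 0 < L -> L <= Dh -> 0 < a ->
  (P [set w | (xi w < k / lamB)%R] < (1 - a)%:E)%E ->
  opt (VaR P L a) X \/ opt (ESP P L (L * a)) X ->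
  exists c, cutoff_solution L a c X.
Proof.
move=> L0 LDh a0 Pa optX.
have [aX sX] : admissible X /\ ESP P L (L * a) X.
  by case: optX => /optimalP[aX CX _]; split => //; exact: VaR_ESP (ltW L0) _ _.
have [|c bc Pc] := exists_quantile mxi xi_gt0 xi_int xi_atomless threshold_gt0 Pa.
  by rewrite ltrBlDr ltrDl.
have [|X' cX'] := exists_cutoff_solution L0 LDh (ltW bc) Pc; first by exists X.
exists c; apply: (cutoff_solution_ae_eq cX' aX).
apply: (cutoff_ESP cX' aX sX).2.
have aX' := cutoff_admissible cX'.
case: optX => /optimalP[_ _]; apply => //.
- by have /optimalP[] := cutoff_optimal_VaR L0 cX'.
- by have /optimalP[] := cutoff_optimal_ESP L0 cX'.
Qed.

(** * Optimal constraints are tight *)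

Section slack.
Variables (L a c : R) (X : Om -> R).
Hypotheses (L0 : 0 < L) (LDh : L <= Dh) (a0 : 0 < a).
Hypothesis Pa : (P [set w | (xi w < k / lamB)%R] < (1 - a)%:E)%E.
Hypothesis cX : cutoff_solution L a c X.

(** Relaxing the default probability from [a] to [a'] strictly improves the
    value, because the more tightly constrained solution is feasible for the
    relaxed problem without being its unique optimum. *)
Lemma cutoff_improvement a' : a < a' ->
  (P [set w | (xi w < k / lamB)%R] < (1 - a')%:E)%E ->
  exists c' X', [/\ cutoff_solution L a' c' X', c' <= c &
    mean (fun w => u (X w)) < mean (fun w => u (X' w))].
Proof.
move=> aa' Pa'; have aX := cutoff_admissible cX.
have [|c' bc' Pc'] :=
  exists_quantile mxi xi_gt0 xi_int xi_atomless threshold_gt0 Pa'.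
  by rewrite ltrBlDr ltrDl (lt_trans a0).
have sX : ESP P L (L * a') X.
  apply/ESP_mean; rewrite ?(ltW L0)// (cutoff_mean_shortfall L0 cX).
  by rewrite ler_pM2l// ltW.
have [|X' cX'] := exists_cutoff_solution L0 LDh (ltW bc') Pc'; first by exists X.
exists c', X'; split => //.
  rewrite leNgt; apply/negP => cc'.
  have : (P [set w | (xi w < c)%R] <= P [set w | (xi w < c')%R])%E.
    apply: probability_ae_le; try exact: measurable_lt_set.
    by apply: aeW => w /= /lt_trans; apply.
  by rewrite Pc' (cutoff_quantile cX) lee_fin; lra.
rewrite ltNge; apply/negP => /(cutoff_ESP cX' aX sX).2 XX'.
have mX := admissible_measurable aX.
have mX' := admissible_measurable (cutoff_admissible cX').
have : L * a = L * a'.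
  rewrite -(cutoff_mean_shortfall L0 cX) -(cutoff_mean_shortfall L0 cX').
  apply: mean_ae_eq; try exact: shortfall_measurable.
  by apply: filterS XX' => w ->.
by move/(mulfI (lt0r_neq0 L0)) => aa; rewrite aa ltxx in aa'.
Qed.

Lemma exists_relaxation del : 0 < del -> exists a', [/\ a < a', a' <= a + del &
  (P [set w | (xi w < k / lamB)%R] < (1 - a')%:E)%E].
Proof.
move=> del0; have mb := measurable_lt_set (k / lamB) mxi.
have Pfin : P [set w | (xi w < k / lamB)%R] \is a fin_num by exact: fin_num_measure.
move: Pa; rewrite -(fineK Pfin) lte_fin.
set p := fine _ => pa.
exists (a + Num.min del ((1 - a - p) / 2)).
have m0 : 0 < Num.min del ((1 - a - p) / 2) by rewrite lt_min del0; lra.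
have m1 : Num.min del ((1 - a - p) / 2) <= del by rewrite ge_min lexx.
have m2 : Num.min del ((1 - a - p) / 2) <= (1 - a - p) / 2.
  by rewrite ge_min lexx orbT.
by rewrite lte_fin; split; lra.
Qed.

Lemma slack_not_optimal (C : set (Om -> R)) del : 0 < del ->
  (forall a' c' X', a < a' -> a' <= a + del -> c' <= c ->
    cutoff_solution L a' c' X' -> C X') -> ~ opt C X.
Proof.
move=> del0 HC /optimalP[aX _ Xmax].
have [a' [aa' a'd Pa']] := exists_relaxation del0.
have [c' [X' [cX' c'c]]] := cutoff_improvement aa' Pa'.
rewrite ltNge => /negP; apply; apply: Xmax; first exact: cutoff_admissible cX'.
exact: HC cX'.
Qed.

Lemma cutoff_unique_VaR : unique (fun b => opt (VaR P L b) X) a.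
Proof.
split; first exact: cutoff_optimal_VaR cX.
move=> b optb; apply/eqP; rewrite eq_le; apply/andP; split.
  have /optimalP[_ + _] := optb.
  by rewrite /VaR/= (cutoff_probability L0 cX) lee_fin => ?; lra.
rewrite leNgt; apply/negP => ab.
apply: (@slack_not_optimal _ (b - a)) optb; first by rewrite subr_gt0.
move=> a' c' X' _ a'b _ cX'.
by rewrite /VaR/= (cutoff_probability L0 cX') lee_fin; lra.
Qed.

Lemma cutoff_unique_ESP : unique (fun eps => opt (ESP P L eps) X) (L * a).
Proof.
split; first exact: cutoff_optimal_ESP cX.
have aX := cutoff_admissible cX.
move=> eps opte; apply/eqP; rewrite eq_le; apply/andP; split.
  have /optimalP[_ /(ESP_mean _ (ltW L0) aX) + _] := opte.
  by rewrite (cutoff_mean_shortfall L0 cX).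
rewrite leNgt; apply/negP => ae.
apply: (@slack_not_optimal _ ((eps - L * a) / L)) opte.
  by rewrite divr_gt0// subr_gt0.
move=> a' c' X' _ a'e _ cX'.
apply/(ESP_mean _ (ltW L0) (cutoff_admissible cX')).
rewrite (cutoff_mean_shortfall L0 cX').
have : L * a' <= L * (a + (eps - L * a) / L) by rewrite ler_pM2l.
rewrite mulrDr (mulrC L (_ / L)) divfK ?gt_eqF//; lra.
Qed.

Lemma cutoff_unique_ESQ : unique (fun eps => opt (ESQ P xi L eps) X)
  (L * mean (fun w => \1_[set w | c <= xi w] w * xi w)).
Proof.
split; first exact: cutoff_optimal_ESQ cX.
have aX := cutoff_admissible cX.
have ige b : intg (fun w => \1_[set w | b <= xi w] w * xi w).
  by apply: integrable_indic_mul => //; exact: measurable_ge_set.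
move=> eps opte; apply/eqP; rewrite eq_le; apply/andP; split.
  have /optimalP[_ /(ESQ_mean _ (ltW L0) aX) + _] := opte.
  by rewrite (cutoff_mean_weighted_shortfall L0 cX).
set e0 := L * _; rewrite leNgt; apply/negP => ee.
(* lowering the cutoff from [c] to [c'] adds at most [c (a' - a)] to the cost of
   the defaulting states *)
pose K := L * Num.max c 1.
have c1 : 0 < Num.max c 1 by rewrite lt_max ltr01 orbT.
have K0 : 0 < K by rewrite mulr_gt0.
apply: (@slack_not_optimal _ ((eps - e0) / K)) opte.
  by rewrite divr_gt0// subr_gt0.
move=> a' c' X' aa' a'e c'c cX'.
apply/(ESQ_mean _ (ltW L0) (cutoff_admissible cX')).
rewrite (cutoff_mean_weighted_shortfall L0 cX').
have i1 := integrable_xi_ge c; have i2 := integrable_xi_ge c'.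
have i12 : intg (fun w => \1_[set w | c' <= xi w] w - \1_[set w | c <= xi w] w).
  exact: integrableBr.
have : mean (fun w => \1_[set w | c' <= xi w] w * xi w) <=
    mean (fun w => \1_[set w | c <= xi w] w * xi w
      + c * (\1_[set w | c' <= xi w] w - \1_[set w | c <= xi w] w)).
  apply: ae_le_mean => //.
    by apply: integrableDr => //; exact: integrableZr.
  apply: aeW => w; rewrite !indic_ge_set; case: (leP c (xi w)) => cx.
    by rewrite (le_trans c'c cx)/=; lra.
  by case: (leP c' (xi w)) => c'x /=; lra.
rewrite RintegralD//; last exact: integrableZr.
rewrite RintegralZl// RintegralB//.
rewrite (mean_xi_ge (cutoff_quantile cX)) (mean_xi_ge (cutoff_quantile cX')).
rewrite -(ler_pM2l L0) mulrDr -/e0 => /le_trans; apply.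
have cc1 : c <= Num.max c 1 by rewrite le_max lexx.
have : L * (c * (a' - a)) <= K * (a' - a).
  by rewrite mulrA ler_wpM2r ?subr_ge0 ?(ltW aa')// ler_pM2l.
have : K * (a' - a) <= K * ((eps - e0) / K) by rewrite ler_pM2l//; lra.
rewrite (mulrC K (_ / K)) divfK ?gt_eqF//; lra.
Qed.

End slack.

Lemma benchmark_insured L : L <= Dh ->
  (P [set w | (xi w < k / lamB)%R] <= P [set w | (L <= XB w)%R])%E.
Proof.
move=> LDh; apply: probability_ae_le; first exact: measurable_lt_set.
  by apply: measurable_ge_set; case: XBopt => -[[]].
apply: filterS xi_gt0 => w w0 /= wb; rewrite /benchmark wb.
apply: (le_trans LDh); apply: (benchmark_demand_ge hU hDh).
  by rewrite mulr_gt0.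
by rewrite -benchmark_slope.
Qed.

End market.

(** * Average value at risk *)

Section average_value_at_risk.
Variables (R : realType) (d : measure_display) (Om : measurableType d).
Variables (P : probability Om R) (X : Om -> R).
Hypothesis X0 : forall w, 0 <= X w.
Implicit Types al be l p : R.
Local Open Scope ereal_scope.

Lemma value_at_risk_le be be' : (be <= be')%R ->
  value_at_risk P X be <= value_at_risk P X be'.
Proof.
move=> bb; apply: le_ereal_sup => _ [x /= xb <-]; exists x => //=.
by apply: (le_trans xb); rewrite lee_fin.
Qed.

Lemma value_at_risk_ge be l : P [set w | (X w < l)%R] <= be%:E ->
  l%:E <= value_at_risk P X be.
Proof. by move=> lb; apply: ereal_sup_ubound; exists l. Qed.

Lemma value_at_risk_ge0 be : (0 <= be)%R -> 0 <= value_at_risk P X be.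
Proof.
move=> b0; apply: value_at_risk_ge.
have -> : [set w | (X w < 0)%R] = set0.
  by apply/seteqP; split=> w //=; rewrite ltNge X0.
by rewrite measure0 lee_fin.
Qed.

Lemma value_at_risk_measurable D : measurable D ->
  measurable_fun D (value_at_risk P X).
Proof.
move=> mD; apply: (measurability (@ErealGenCInfty.G R)) => [|/= _ [_] [r] -> <-].
  exact: ErealGenCInfty.measurableE.
apply: measurableI => //; apply: is_interval_measurable => s t/=.
rewrite !in_itv/= !andbT => fs ft v /andP[sv vt].
by rewrite in_itv/= andbT (le_trans fs)// value_at_risk_le.
Qed.

(** The value at risk is nonnegative at nonnegative levels, and at least [l] at
    the levels above [p]. *)
Lemma AVaR_ge al l p LA : (0 < al)%R -> (0 <= l)%R -> (0 <= p)%R ->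
  P [set w | (X w < l)%R] <= p%:E -> (al * LA <= l * (al - p))%R ->
  AVaR P al LA X.
Proof.
move=> al0 l0 p0 Pl lLA; rewrite /AVaR/=.
set I := (\int[_]_(_ in _) _)%E.
suff lI : (l * (al - p))%:E <= I.
  have -> : LA%:E = (al^-1)%:E * (al * LA)%:E.
    by rewrite -EFinM mulKf// gt_eqF.
  apply: lee_wpmul2l; first by rewrite lee_fin invr_ge0 ltW.
  by apply: le_trans lI; rewrite lee_fin.
have [alp|pal] := leP al p.
  apply: (@le_trans _ _ 0).
    by rewrite lee_fin mulr_ge0_le0// subr_le0.
  by apply: integral_ge0 => be /=; rewrite in_itv/= => /andP[b0 _]; exact: value_at_risk_ge0.
have mI (i : interval R) : measurable [set` i] by exact: measurable_itv.
apply: (@le_trans _ _ (\int[lebesgue_measure]_(be in `[p, al]) value_at_risk P X be)).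
  apply: (@le_trans _ _ (\int[lebesgue_measure]_(be in `[p, al]) (cst l%:E) be)).
    rewrite integral_cst; last exact: mI.
    rewrite /= lebesgue_measure_itv/= lte_fin pal.
    by rewrite -EFinB -EFinM.
  apply: ge0_le_integral => //.
  - exact: value_at_risk_measurable.
  - move=> be /=; rewrite in_itv/= => /andP[pb _]; apply: value_at_risk_ge.
    by apply: (le_trans Pl); rewrite lee_fin.
apply: ge0_subset_integral => //.
- exact: value_at_risk_measurable.
- by move=> be /=; rewrite in_itv/= => /andP[b0 _]; exact: value_at_risk_ge0.
- by apply: subset_itvr; rewrite bnd_simp.
Qed.

End average_value_at_risk.

(** * Equivalence of the constraints *)

Theorem corollary1 (R : realType) (d : measure_display)
    (Om : measurableType d) (P : probability Om R)
    (m : nat) (M : market R Om m) (U : R -> R) (D Dh x0 lamB : R) :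
  let xi := state_price P M in
  let opt := optimal P M U D x0 in
  let XB := benchmark U D Dh lamB xi in
  complete_market P M ->
  atomless_rv P xi ->
  ('E_P[xi] < +oo)%E ->
  0 < x0 -> 0 < D ->
  utility U ->
  unique (tangency_point U D) Dh ->
  0 < lamB -> ('E_P[(fun w => xi w * XB w)%R] = x0%:E)%E ->
  opt setT XB ->
  (forall L alpha : R, 0 < alpha < 1 -> L <= Dh ->
     ~ VaR P L alpha XB ->
   forall X : Om -> R, opt (VaR P L alpha) X ->
   exists epsQ epsP : R,
     [/\ unique (fun eps => opt (ESQ P xi L eps) X) epsQ,
         unique (fun eps => opt (ESP P L eps) X) epsP,
         forall Y, opt (VaR P L alpha) Y -> {ae P, forall w, Y w = X w},
         forall Y, opt (ESP P L epsP) Y -> {ae P, forall w, Y w = X w} &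
         D < L -> forall Y, opt (ESQ P xi L epsQ) Y ->
           {ae P, forall w, Y w = X w}])
  /\
  (forall alpha LA Ls : R, 0 < alpha < 1 -> LA < Ls -> Ls <= Dh ->
     ~ AVaR P alpha LA XB ->
   forall X : Om -> R, opt (AVaR P alpha LA) X ->
     opt (ESP P Ls (alpha * (Ls - LA))) X ->
   exists alphaS epsQ epsP : R,
     0 < alphaS < 1 /\
     [/\ unique (fun a => opt (VaR P Ls a) X) alphaS,
         unique (fun eps => opt (ESQ P xi Ls eps) X) epsQ &
         unique (fun eps => opt (ESP P Ls eps) X) epsP] /\
     [/\ forall Y, opt (VaR P Ls alphaS) Y -> {ae P, forall w, Y w = X w},
         forall Y, opt (ESP P Ls epsP) Y -> {ae P, forall w, Y w = X w} &
         D < Ls -> forall Y, opt (ESQ P xi Ls epsQ) Y ->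
           {ae P, forall w, Y w = X w}]).
Proof.
move=> xi opt XB hM xi_atomless xi_lty x0_gt0 D0 hU [hDh _] lamB0 _ XBopt.
have XB0 w : 0 <= XB w by case: XBopt => -[[_ _ +]] => /(_ w).
have mXB : measurable_fun setT XB by case: XBopt => -[[]].
pose b := derive1 U (Dh - D) / lamB.
have insured L : L <= Dh ->
    (P [set w | (xi w < b)%R] <= P [set w | (L <= XB w)%R])%E.
  by move=> LDh; exact: benchmark_insured hM hU hDh lamB0 XBopt _ LDh.
have positive L alpha : 0 < alpha -> ~ VaR P L alpha XB -> 0 < L.
  move=> a0 nV; rewrite ltNge; apply/negP => L0; apply: nV.
  rewrite /VaR/= (_ : [set w | _] = setT) ?probability_setT ?lee_fin; first lra.
  by apply/seteqP; split=> w //= _; exact: le_trans (XB0 w).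
split.
- move=> L alpha /andP[a0 _] LDh nV X optX.
  have L0 := positive _ _ a0 nV.
  have Pa : (P [set w | (xi w < b)%R] < (1 - alpha)%:E)%E.
    by rewrite ltNge; apply/negP => /le_trans H; apply: nV; apply: H; exact: insured.
  have [c cX] := optimal_cutoff_solution hM xi_atomless xi_lty D0 hU hDh lamB0
    XBopt L0 LDh a0 Pa (or_introl optX).
  have [uV uP uQ] := cutoff_unique_solution hM xi_lty hU XBopt L0 cX.
  exists (L * (\int[P]_w (\1_[set w | c <= xi w] w * xi w))%R), (L * alpha).
  split => //.
  + exact: (cutoff_unique_ESQ hM xi_atomless xi_lty D0 hU hDh lamB0
      XBopt L0 LDh a0 Pa cX).
  + exact: (cutoff_unique_ESP hM xi_atomless xi_lty D0 hU hDh lamB0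
      XBopt L0 LDh a0 Pa cX).
- move=> alpha LA Ls /andP[a0 a1] LALs LsDh nA X _ optX.
  have Ls0 : 0 < Ls.
    rewrite ltNge; apply/negP => Ls0; apply: nA.
    apply: (@AVaR_ge _ _ _ P XB XB0 alpha 0 0) => //.
      rewrite (_ : [set w | _] = set0) ?measure0//.
      by apply/seteqP; split=> w //=; rewrite ltNge XB0.
    by rewrite mul0r pmulr_rle0//; lra.
  pose aS := alpha * (Ls - LA) / Ls.
  have LsaS : Ls * aS = alpha * (Ls - LA) by rewrite mulrC divfK// gt_eqF.
  have aS0 : 0 < aS by rewrite divr_gt0// mulr_gt0// subr_gt0.
  have Pa : (P [set w | (xi w < b)%R] < (1 - aS)%:E)%E.
    rewrite ltNge; apply/negP => Pb; apply: nA.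
    apply: (@AVaR_ge _ _ _ P XB XB0 alpha Ls aS) => //; first exact: ltW.
    - exact: ltW.
    - have mL : measurable [set w | (Ls <= XB w)%R] by exact: measurable_ge_set.
      have -> : [set w | (XB w < Ls)%R] = ~` [set w | (Ls <= XB w)%R].
        by rewrite ge_setE setCK.
      rewrite probability_setC//.
      have := le_trans Pb (insured _ LsDh).
      have Pfin : P [set w | (Ls <= XB w)%R] \is a fin_num by exact: fin_num_measure.
      by rewrite -(fineK Pfin) -EFinB !lee_fin; lra.
    - by rewrite mulrBr LsaS; lra.
  rewrite -LsaS in optX.
  have [c cX] := optimal_cutoff_solution hM xi_atomless xi_lty D0 hU hDh lamB0
    XBopt Ls0 LsDh aS0 Pa (or_intror optX).
  exists aS, (Ls * (\int[P]_w (\1_[set w | c <= xi w] w * xi w))%R), (Ls * aS).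
  split.
    rewrite aS0/= -subr_gt0 -lte_fin; apply: le_lt_trans Pa.
    exact: measure_ge0.
  split; last exact: (cutoff_unique_solution hM xi_lty hU XBopt Ls0 cX).
  split.
  + exact: (cutoff_unique_VaR hM xi_atomless xi_lty D0 hU hDh lamB0
      XBopt Ls0 LsDh aS0 Pa cX).
  + exact: (cutoff_unique_ESQ hM xi_atomless xi_lty D0 hU hDh lamB0
      XBopt Ls0 LsDh aS0 Pa cX).
  + exact: (cutoff_unique_ESP hM xi_atomless xi_lty D0 hU hDh lamB0
      XBopt Ls0 LsDh aS0 Pa cX).
Qed.
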